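(* Let $V\subset\mathbb{C}^4$ be a generic complex affine plane, $V^\times=V\cap(\mathbb{C}^\times)^4$, and let $Z\subset V^\times$ be the set of critical points of the rolled coamoeba map $\mathcal{B}:V^\times\to(\mathbb{R}P^1)^4$ (equivalently, of the amoeba map or of the coamoeba map of $V$). Then $Z$ is a nonsingular 3-manifold.
   Context: Notation: $\mathbb{C}^\times=\mathbb{C}\setminus\{0\}$. A complex affine plane in $\mathbb{C}^4$ is a complex affine subspace of complex dimension 2. ''Generic'' means: outside a proper real-algebraic subset of the space of all complex affine planes in $\mathbb{C}^4$. The coordinatewise maps $Log:(\mathbb{C}^\times)^4\to\mathbb{R}^4$, $z\mapsto\log|z|$; $2Arg:(\mathbb{C}^\times)^4\to(\mathbb{R}P^1)^4$, $z\mapsto[\mathrm{Re}(z):\mathrm{Im}(z)]$; and $Arg:(\mathbb{C}^\times)^4\to(S^1)^4$, $z\mapsto z/|z|$, restrict to $V^\times$ as the amoeba map $\mathcal{A}$, the rolled coamoeba map $\mathcal{B}$ and the coamoeba map $\mathcal{C}$ respectively. Each is a smooth map between real 4-dimensional manifolds; critical points are the points where the real differential is not surjective. The three maps have the same set of critical points, denoted $Z$. *)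

(* Defs.v *)
(* MathComp-Analysis; mpoly is not imported, its notations clash with those of
   analysis. *)
From HB Require Import structures.
From mathcomp Require Import all_boot all_order all_algebra.
From mathcomp Require Import all_classical all_reals all_analysis.
From mathcomp Require Import complex.
From mathcomp Require mpoly.

Set Implicit Arguments.
Unset Strict Implicit.
Unset Printing Implicit Defensive.

Import Order.TTheory GRing.Theory Num.Theory.
Import numFieldNormedType.Exports.

Local Open Scope classical_set_scope.
Local Open Scope ring_scope.

Section Submanifolds.
Variable R : realType.

(* f is of class C^k on the open set U.  In finite dimension, differentiability
   of f together with C^(k-1) directional derivatives is the usual notion. *)
Fixpoint class_C (m n k : nat) (U : set 'rV[R]_m) (f : 'rV[R]_m -> 'rV[R]_n) :
    Prop :=
  if k is k'.+1 then
    (forall x, U x -> differentiable f x) /\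
    (forall v, class_C k' U (fun x => 'D_v f x))
  else forall x, U x -> {for x, continuous f}.

Definition smooth_on (m n : nat) (U : set 'rV[R]_m) (f : 'rV[R]_m -> 'rV[R]_n) :
    Prop :=
  forall k, class_C k U f.

(* phi, with inverse psi, is a diffeomorphism from U onto W. *)
Definition diffeomorphism (n : nat) (U W : set 'rV[R]_n)
    (phi psi : 'rV[R]_n -> 'rV[R]_n) : Prop :=
  [/\ open U, open W, smooth_on U phi, smooth_on W psi &
      [/\ forall x, U x -> W (phi x), forall y, W y -> U (psi y),
          forall x, U x -> psi (phi x) = x & forall y, W y -> phi (psi y) = y]].

(* Z is an embedded smooth submanifold of R^n of dimension k: around each of its
   points some diffeomorphism straightens Z to the coordinate subspace
   R^k x {0}. *)
Definition smooth_submanifold (n k : nat) (Z : set 'rV[R]_n) : Prop :=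
  forall p, Z p -> exists U W phi psi,
    [/\ diffeomorphism U W phi psi, U p &
        forall x, U x ->
          (Z x <-> forall j : 'I_n, (k <= j)%N -> phi x 0 j = 0)].

End Submanifolds.

Section AffinePlanes.
Variable R : realType.
Local Notation C := (R[i]).

Definition affine_plane_of (a : 'rV[C]_4) (D : 'M[C]_(2, 4)) : set 'rV[C]_4 :=
  [set z | (z - a <= D)%MS].

Definition affine_plane (V : set 'rV[C]_4) : Prop :=
  exists (a : 'rV[C]_4) (D : 'M[C]_(2, 4)), row_free D /\ V = affine_plane_of a D.

(* The 24 real coordinates of a base point and a pair of spanning vectors. *)
Definition frame_coords (a : 'rV[C]_4) (D : 'M[C]_(2, 4)) :
    'rV[R]_(3 * 4 + 3 * 4) :=
  let M : 'M[C]_(3, 4) := col_mx a D in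
  row_mx (mxvec (map_mx (@complex.Re R) M)) (mxvec (map_mx (@complex.Im R) M)).

(* The space of affine planes is the quotient of the space of frames (a, D), D of
   rank 2, by the algebraic group of affine reparametrizations, and
   (a, D) |-> affine_plane_of a D is a Zariski-locally trivial principal bundle.
   So a set X of planes is real-algebraic iff its preimage in the space of frames
   is cut out by real polynomials in the real coordinates of the frame. *)
Definition real_algebraic (X : set (set 'rV[C]_4)) : Prop :=
  exists ps : seq (mpoly.mpoly (3 * 4 + 3 * 4) R),
    forall (a : 'rV[C]_4) (D : 'M[C]_(2, 4)), row_free D ->
      (X (affine_plane_of a D) <->
       all (fun p => mpoly.meval (frame_coords a D 0) p == 0) ps).

Definition for_generic_plane (P : set 'rV[C]_4 -> Prop) : Prop :=
  exists X : set (set 'rV[C]_4),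
    [/\ real_algebraic X,
        exists2 V, affine_plane V & ~ X V &
        forall V, affine_plane V -> ~ X V -> P V].

End AffinePlanes.

Section RolledCoamoeba.
Variable R : realType.
Local Notation C := (R[i]).

Definition complex_of_real8 (x : 'rV[R]_(4 + 4)) : 'rV[C]_4 :=
  \row_i Complex (x 0 (lshift 4 i)) (x 0 (rshift 4 i)).

Definition real8_of_complex (z : 'rV[C]_4) : 'rV[R]_(4 + 4) :=
  row_mx (map_mx (@complex.Re R) z) (map_mx (@complex.Im R) z).

(* A point of RP^1 is a line in R^2, i.e. a subspace of dimension 1. *)
Definition homog (x y : R) : {vspace (R^o * R^o)%type} :=
  (<[ (x : R^o, y : R^o) ]>)%VS.

(* The standard affine charts of RP^1: chart true is [1 : r] |-> r, and
   chart false is [r : 1] |-> r. *)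
Definition RP1_chart_inv (e : bool) (r : R) : {vspace (R^o * R^o)%type} :=
  if e then homog 1 r else homog r 1.

Definition RP1_chart_dom (e : bool) : set {vspace (R^o * R^o)%type} :=
  range (RP1_chart_inv e).

Definition RP1_chart (e : bool) (L : {vspace (R^o * R^o)%type}) : R :=
  xget 0 [set r | RP1_chart_inv e r = L].

(* Where all coordinates are nonzero, this takes values in (RP^1)^4. *)
Definition twoArg (z : 'rV[C]_4) (i : 'I_4) : {vspace (R^o * R^o)%type} :=
  homog (complex.Re (z 0 i)) (complex.Im (z 0 i)).

Definition torus_part (V : set 'rV[C]_4) : set 'rV[C]_4 :=
  [set z | V z /\ forall i, z 0 i != 0].

Definition direction (V : set 'rV[C]_4) : set 'rV[C]_4 :=
  [set v | exists x y, [/\ V x, V y & v = x - y]].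

(* 2Arg, read in the product chart of (RP^1)^4 given by e and in the real
   coordinates of C^4. *)
Definition twoArg_in_chart (e : 'I_4 -> bool) (x : 'rV[R]_(4 + 4)) : 'rV[R]_4 :=
  \row_i RP1_chart (e i) (twoArg (complex_of_real8 x) i).

(* V^x is open in V, so its tangent space at z is the direction of V, and the
   differential at z of the restriction of 2Arg to V^x is the restriction of the
   differential of 2Arg to that space.  Its surjectivity does not depend on the
   chart around the image of z. *)
Definition rolled_coamoeba_critical (V : set 'rV[C]_4) : set 'rV[C]_4 :=
  [set z | torus_part V z /\
    exists e : 'I_4 -> bool,
      (forall i, RP1_chart_dom (e i) (twoArg z i)) /\
      ~ (forall w : 'rV[R]_4, exists2 v, direction V v &
           'd (twoArg_in_chart e) (real8_of_complex z) (real8_of_complex v) = w)].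

End RolledCoamoeba.

(* Main.v *)
Require Import Defs.
From HB Require Import structures.
From mathcomp Require Import all_boot all_order all_algebra.
From mathcomp Require Import all_classical all_reals all_analysis.
From mathcomp Require Import complex perm ring lra.
From mathcomp Require mpoly.

(** Let V = a + W be a plane, W being the row space of D, and let z be a point of V with nonzero
    coordinates.  In a chart of the projective line the differential of the argument of z_j is
    v |-> Im (conj z_j v_j), up to a nonzero factor.  So z is critical exactly when the real
    4 x 4 matrix M (z) of these four forms in a real basis of W is singular (criticalP), and the
    critical set is the hypersurface det M = 0 of the torus part of V.  It is smooth as soon
    as det M has a nonzero derivative along V at each of its zeros (straighten_affine).

    This nondegeneracy (arg_det_regular) is where genericity enters.  A vector of the left
    kernel of M (z) is a vector w of W with w_j = r_j z_j and r_j real.  A vector of the right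
    kernel is a real lam such that the form with coefficients lam_j conj z_j vanishes on W.

    If the left kernel had dimension at least 2, two such vectors r z would span W; the
    minors of D and of (a, D) would be products of coordinates of z by real numbers, up to
    common factors, and a cross-ratio of these minors would be real
    (real_span_cross_ratio).  So for generic V the kernel is a line, the cofactor matrix of
    M (z) is the rank one matrix l * lam, nonzero by cofactor_neq0, and by Jacobi's formula
    (grad_det) the derivative of det M along v is a multiple of the sum of the
    lam_j Im (conj v_j w_j).  If it vanished for every v in W, the form with coefficients
    r_j lam_j conj z_j would vanish on W too.  Two independent forms that vanish on W and have
    real ratios of coefficients force the cross-ratio of the four coordinate forms on W to be
    real, and the degenerate case in which three of the r_j are equal is excluded by the
    position of a (real_annihilators, three_equal).

    The conditions used are the nonvanishing of a single real polynomial in the minors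
    (genericity).  A change of frame multiplies it by a nonnegative factor, so it defines a
    real-algebraic set of planes, and this set is proper because it misses an explicit
    plane (sample_generic).

    On the analytic side, smooth functions are handled through slopes, jointly continuous
    functions h_j with f y - f x equal to the sum of the (y_j - x_j) h_j (x, y).  This form of
    differentiability is preserved by all the operations needed, including the resolution of an
    implicit equation, and it implies the usual one (slopes_diff, Ck_class_C). *)

Set Implicit Arguments.
Unset Strict Implicit.
Unset Printing Implicit Defensive.

Import Order.TTheory GRing.Theory Num.Theory.
Import numFieldNormedType.Exports.

Local Open Scope classical_set_scope.
Local Open Scope ring_scope.
Local Open Scope complex_scope.

Local Notation Im := (@complex.Im _).
Local Notation Re := (@complex.Re _).

(** * Continuity at a point and row vectors *)

Section RowVectors.
Variable R : realType.

Lemma continuous_at_cst (T : topologicalType) (x : T) (c : R) :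
  {for x, continuous (fun=> c)}.
Proof. exact: cvg_cst. Qed.

Lemma continuous_at_sum (T : topologicalType) (x : T) (I : Type) (s : seq I)
    (f : I -> T -> R) :
  (forall i, {for x, continuous (f i)}) ->
  {for x, continuous (fun y => \sum_(i <- s) f i y)}.
Proof.
move=> fa; elim: s => [|i s IH].
  have -> : (fun y => \sum_(i <- [::]) f i y) = (fun=> 0).
    by apply: funext => y; rewrite big_nil.
  exact: continuous_at_cst.
have -> : (fun y => \sum_(j <- i :: s) f j y) = f i + (fun y => \sum_(j <- s) f j y).
  by apply: funext => y; rewrite big_cons.
exact: continuousD.
Qed.

Lemma continuous_at_pair (T U V : topologicalType) (x : T) (f : T -> U) (g : T -> V) :
  {for x, continuous f} -> {for x, continuous g} ->
  {for x, continuous (fun y => (f y, g y))}.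
Proof. by move=> fc gc; exact: cvg_pair. Qed.

Lemma continuous_at_near_eq (T : topologicalType) (x : T) (U : set T) (f g : T -> R) :
  nbhs x U -> (forall y, U y -> f y = g y) ->
  {for x, continuous f} -> {for x, continuous g}.
Proof.
move=> Ux fg; have gx : g x = f x by rewrite fg //; exact: nbhs_singleton.
rewrite /prop_for /continuous_at gx; apply: cvg_trans; apply: near_eq_cvg.
by apply: filterS Ux => y; exact: fg.
Qed.

Lemma continuous_at_comp (T U V : topologicalType) (x : T) (f : T -> U) (g : U -> V) :
  {for x, continuous f} -> {for f x, continuous g} ->
  {for x, continuous (fun y => g (f y))}.
Proof. by move=> fc gc; exact: (continuous_comp fc gc). Qed.

Lemma continuous_at_fst (T U V : topologicalType) (f : T -> V) (x : T) (y : U) :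
  {for x, continuous f} -> {for (x, y), continuous (fun q : T * U => f q.1)}.
Proof.
move=> fc; apply: (@continuous_at_comp _ _ _ (x, y) fst f) => //; exact: cvg_fst.
Qed.

Lemma continuous_at_snd (T U V : topologicalType) (f : U -> V) (x : T) (y : U) :
  {for y, continuous f} -> {for (x, y), continuous (fun q : T * U => f q.2)}.
Proof.
move=> fc; apply: (@continuous_at_comp _ _ _ (x, y) snd f) => //; exact: cvg_snd.
Qed.

Lemma continuous_at_rV (T : topologicalType) (x : T) m (f : T -> 'rV[R]_m) :
  (forall j, {for x, continuous (fun y => f y 0 j)}) -> {for x, continuous f}.
Proof.
move=> fl A [P Pl PA]; rewrite /nbhs /=.
have : \forall y \near x, forall j, P 0 j (f y 0 j).
  by apply: filter_forall => j; apply: (fl j); exact: Pl.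
by apply: filterS => y Py; apply: PA => i j; rewrite ord1.
Qed.

Lemma continuous_mulmxr m n (A : 'M[R]_(m, n)) : continuous (fun v : 'rV[R]_m => v *m A).
Proof.
move=> v; apply: continuous_at_rV => j.
have -> : (fun y : 'rV[R]_m => (y *m A) 0 j) = (fun y => \sum_i y 0 i * A i j).
  by apply: funext => y; rewrite mxE.
apply: continuous_at_sum => i; apply: continuousM; first exact: coord_continuous.
exact: continuous_at_cst.
Qed.

Lemma ler_coord_norm m (x : 'rV[R]_m) j : `|x 0 j| <= `|x|.
Proof.
rewrite [leRHS]/Num.Def.normr /= mx_normrE.
exact: (le_bigmax _ (fun ij => `|x ij.1 ij.2|) (0, j)).
Qed.

Lemma rV_norm_le m (x : 'rV[R]_m) e : 0 <= e -> (forall j, `|x 0 j| <= e) -> `|x| <= e.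
Proof.
move=> e0 xe; rewrite [leLHS]/Num.Def.normr /= mx_normrE bigmax_le //= => -[i j] _.
by rewrite ord1.
Qed.

Lemma rV_norm_lt m (x : 'rV[R]_m) e : 0 < e -> (forall j, `|x 0 j| < e) -> `|x| < e.
Proof.
move=> e0 xe; rewrite [ltLHS]/Num.Def.normr /= mx_normrE; apply/bigmax_ltP; split=> // -[i j] _.
by rewrite ord1.
Qed.

End RowVectors.

(** * Smoothness by continuous slopes *)

Section Slopes.
Variable R : realType.

(** A form of continuous differentiability without limits of quotients: on the diagonal, h j
    is the j-th partial derivative of f, and the joint continuity of h replaces the mean value
    theorem, since the increments of f between two arbitrary points are controlled at once.
    The identity is algebraic, so it survives products, inverses, composition and the
    resolution of implicit equations. *)
Definition slopes m (U : set 'rV[R]_m) (f : 'rV[R]_m -> R)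
    (h : 'I_m -> 'rV[R]_m * 'rV[R]_m -> R) : Prop :=
  (forall j x y, U x -> U y -> {for (x, y), continuous (h j)}) /\
  (forall x y, U x -> U y ->
     f y - f x = \sum_j (y 0 j - x 0 j) * h j (x, y)).

(** Nothing is asked for k = 0: the slopes at one level already make f continuous, so that
    Ck k.+1 implies the class C^k. *)
Fixpoint Ck m k (U : set 'rV[R]_m) (f : 'rV[R]_m -> R) : Prop :=
  if k is k'.+1 then
    exists2 h, slopes U f h & forall j, Ck k' U (fun x => h j (x, x))
  else True.

Lemma Ck_eq m k (U : set 'rV[R]_m) f g :
  (forall x, U x -> f x = g x) -> Ck k U f -> Ck k U g.
Proof.
case: k => [//|k] fg /= [h [hc hE] hk]; exists h => //; split=> // x y Ux Uy.
by rewrite -!fg // hE.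
Qed.

Lemma Ck_sub m k (U U' : set 'rV[R]_m) f : U' `<=` U -> Ck k U f -> Ck k U' f.
Proof.
move=> sU; elim: k f => [//|k IH] f /= [h [hc hE] hk]; exists h.
  by split=> [j x y /sU Ux /sU Uy|x y /sU Ux /sU Uy]; [exact: hc|exact: hE].
by move=> j; apply: IH.
Qed.

Lemma Ck_pred m k (U : set 'rV[R]_m) f : Ck k.+1 U f -> Ck k U f.
Proof.
elim: k f => [//|k IH] f [h hS hk]; exists h => // j; exact: IH.
Qed.

Lemma slopes_continuous m (U : set 'rV[R]_m) f h x :
  open U -> slopes U f h -> U x -> {for x, continuous f}.
Proof.
move=> oU [hc hE] Ux.
pose F (y : 'rV[R]_m) : R := f x + \sum_j (y 0 j - x 0 j) * h j (x, y).
have FE y : U y -> F y = f y by move=> Uy; rewrite /F -hE // addrC subrK.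
have : {for x, continuous F}.
  apply: continuousD; first exact: continuous_at_cst.
  apply: continuous_at_sum => j; apply: continuousM.
    by apply: continuousB; [exact: coord_continuous|exact: continuous_at_cst].
  apply: (@continuous_at_comp _ _ _ x (fun y : 'rV[R]_m => (x, y)) (h j)); last exact: hc.
  by apply: continuous_at_pair; [exact: cst_continuous|move=> A].
move=> Fc; exact: (continuous_at_near_eq (open_nbhs_nbhs (conj oU Ux)) FE Fc).
Qed.

Lemma slopes_cst m (U : set 'rV[R]_m) c : slopes U (fun=> c) (fun _ _ => 0).
Proof.
split=> [j x y _ _|x y _ _]; first exact: continuous_at_cst.
by rewrite subrr big1 // => j _; rewrite mulr0.
Qed.

Lemma slopes_coord m (U : set 'rV[R]_m) i :
  slopes U (fun x => x 0 i) (fun j _ => (j == i)%:R).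
Proof.
split=> [j x y _ _|x y _ _]; first exact: continuous_at_cst.
by rewrite (bigD1 i) //= eqxx mulr1 big1 ?addr0 // => j /negPf ->; rewrite mulr0.
Qed.

Lemma Ck_cst m k (U : set 'rV[R]_m) c : Ck k U (fun=> c).
Proof.
by elim: k c => [//|k IH] c; exists (fun _ _ => 0); first exact: slopes_cst.
Qed.

Lemma Ck_coord m k (U : set 'rV[R]_m) i : Ck k U (fun x => x 0 i).
Proof.
case: k => [//|k]; exists (fun j _ => (j == i)%:R); first exact: slopes_coord.
by move=> j; exact: Ck_cst.
Qed.

Lemma slopesD m (U : set 'rV[R]_m) f g hf hg : slopes U f hf -> slopes U g hg ->
  slopes U (fun x => f x + g x) (fun j q => hf j q + hg j q).
Proof.
move=> [fc fE] [gc gE]; split=> [j x y Ux Uy|x y Ux Uy].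
  by apply: continuousD; [exact: fc|exact: gc].
under eq_bigr do rewrite mulrDr.
by rewrite big_split /= -fE // -gE // opprD addrACA.
Qed.

Lemma CkD m k (U : set 'rV[R]_m) f g : Ck k U f -> Ck k U g -> Ck k U (fun x => f x + g x).
Proof.
elim: k f g => [//|k IH] f g /= [hf Sf Df] [hg Sg Dg].
by exists (fun j q => hf j q + hg j q); [exact: slopesD|move=> j; exact: IH].
Qed.

Lemma slopesM m (U : set 'rV[R]_m) f g hf hg : open U -> slopes U f hf -> slopes U g hg ->
  slopes U (fun x => f x * g x) (fun j q => hf j q * g q.2 + f q.1 * hg j q).
Proof.
move=> oU Sf Sg; have fcont := slopes_continuous oU Sf; have gcont := slopes_continuous oU Sg.
case: Sf Sg => [fc fE] [gc gE]; split=> [j x y Ux Uy|x y Ux Uy].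
  apply: continuousD; apply: continuousM.
  - exact: fc.
  - exact/continuous_at_snd/gcont.
  - exact/continuous_at_fst/fcont.
  - exact: gc.
under eq_bigr do rewrite mulrDr mulrA (mulrCA _ (f _)).
by rewrite big_split /= -mulr_suml -mulr_sumr -fE // -gE //; ring.
Qed.

Lemma CkM m k (U : set 'rV[R]_m) f g :
  open U -> Ck k U f -> Ck k U g -> Ck k U (fun x => f x * g x).
Proof.
move=> oU; elim: k f g => [//|k IH] f g Cf Cg.
have Cf' := Ck_pred Cf; have Cg' := Ck_pred Cg.
case: Cf => hf Sf Df; case: Cg => hg Sg Dg.
exists (fun j q => hf j q * g q.2 + f q.1 * hg j q); first exact: slopesM.
by move=> j; apply: CkD; [exact: (IH _ _ (Df j) Cg')|exact: (IH _ _ Cf' (Dg j))].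
Qed.

Lemma slopesV m (U : set 'rV[R]_m) f hf : open U -> (forall x, U x -> f x != 0) -> slopes U f hf ->
  slopes U (fun x => (f x)^-1) (fun j q => - hf j q * ((f q.1)^-1 * (f q.2)^-1)).
Proof.
move=> oU f0 Sf; have fcont := slopes_continuous oU Sf.
case: Sf => [fc fE]; split=> [j x y Ux Uy|x y Ux Uy].
  apply: continuousM; first by apply: continuousN; exact: fc.
  apply: continuousM.
    apply: (@continuous_at_fst _ _ _ (fun x => (f x)^-1)).
    by apply: continuousV; [exact: f0|exact: fcont].
  apply: (@continuous_at_snd _ _ _ (fun x => (f x)^-1)).
  by apply: continuousV; [exact: f0|exact: fcont].
under eq_bigr do rewrite mulrA mulrN.
rewrite -mulr_suml sumrN -fE //=.
by field; rewrite !f0.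
Qed.

Lemma CkV m k (U : set 'rV[R]_m) f : open U -> (forall x, U x -> f x != 0) ->
  Ck k U f -> Ck k U (fun x => (f x)^-1).
Proof.
move=> oU f0; elim: k => [//|k IH] Cf.
have Cf' := Ck_pred Cf; have Ci := IH Cf'.
case: Cf => hf Sf Df.
exists (fun j q => - hf j q * ((f q.1)^-1 * (f q.2)^-1)); first exact: slopesV.
move=> j; apply: (CkM oU _ (CkM oU Ci Ci)).
apply: (@Ck_eq _ _ _ (fun x => -1 * hf j (x, x))); first by move=> x _; rewrite mulN1r.
exact: (CkM oU (Ck_cst k U (-1)) (Df j)).
Qed.

Lemma Ck_sum m k (U : set 'rV[R]_m) (I : Type) (s : seq I) (P : pred I) (f : I -> 'rV[R]_m -> R) :
  (forall i, P i -> Ck k U (f i)) -> Ck k U (fun x => \sum_(i <- s | P i) f i x).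
Proof.
move=> Cf; elim: s => [|i s IH].
  by apply: (@Ck_eq _ _ _ (fun=> 0)); [move=> x _; rewrite big_nil|exact: Ck_cst].
case Pi : (P i); last first.
  by apply: (@Ck_eq _ _ _ _ _ _ IH) => x _; rewrite big_cons Pi.
apply: (@Ck_eq _ _ _ (fun x => f i x + \sum_(i <- s | P i) f i x)).
  by move=> x _; rewrite big_cons Pi.
by apply: CkD => //; exact: Cf.
Qed.

Lemma Ck_prod m k (U : set 'rV[R]_m) (I : Type) (s : seq I) (f : I -> 'rV[R]_m -> R) :
  open U -> (forall i, Ck k U (f i)) -> Ck k U (fun x => \prod_(i <- s) f i x).
Proof.
move=> oU Cf; elim: s => [|i s IH].
  by apply: (@Ck_eq _ _ _ (fun=> 1)); [move=> x _; rewrite big_nil|exact: Ck_cst].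
apply: (@Ck_eq _ _ _ (fun x => f i x * \prod_(i <- s) f i x)).
  by move=> x _; rewrite big_cons.
exact: CkM.
Qed.

(** The chain rule holds between any two points, off the diagonal as well. *)
Lemma slopes_comp m n (U : set 'rV[R]_m) (U' : set 'rV[R]_n) (G : 'rV[R]_m -> 'rV[R]_n) f hG hf :
  open U -> (forall x, U x -> U' (G x)) ->
  (forall i, slopes U (fun x => G x 0 i) (hG i)) -> slopes U' f hf ->
  slopes U (fun x => f (G x)) (fun j q => \sum_i hG i j q * hf i (G q.1, G q.2)).
Proof.
move=> oU GU SG [fc fE]; split=> [j x y Ux Uy|x y Ux Uy].
  apply: continuous_at_sum => i; apply: continuousM; first exact: (SG i).1.
  have Gc z : U z -> {for z, continuous G}.
    move=> Uz; apply: continuous_at_rV => l.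
    exact: (slopes_continuous oU (SG l)).
  apply: (@continuous_at_comp _ _ _ (x, y) (fun q : 'rV[R]_m * 'rV[R]_m => (G q.1, G q.2)) (hf i)).
    apply: continuous_at_pair => /=.
      by apply: continuous_at_fst; exact: Gc.
    by apply: continuous_at_snd; exact: Gc.
  by apply: fc => /=; exact: GU.
rewrite fE; [|exact: GU..].
under [RHS]eq_bigr do rewrite mulr_sumr.
rewrite exchange_big /=; apply: eq_bigr => i _.
by rewrite (SG i).2 // mulr_suml; apply: eq_bigr => j _; rewrite mulrA.
Qed.

Lemma Ck_comp m n k (U : set 'rV[R]_m) (U' : set 'rV[R]_n) (G : 'rV[R]_m -> 'rV[R]_n) f :
  open U -> (forall x, U x -> U' (G x)) ->
  (forall i, Ck k U (fun x => G x 0 i)) -> Ck k U' f -> Ck k U (fun x => f (G x)).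
Proof.
move=> oU GU; elim: k f => [//|k IH] f CG [hf Sf Df].
have CG' i := Ck_pred (CG i).
have /choice [hG hGP] : forall i, exists h, slopes U (fun x => G x 0 i) h /\
    forall j, Ck k U (fun x => h j (x, x)).
  by move=> i; case: (CG i) => h ? ?; exists h.
exists (fun j q => \sum_i hG i j q * hf i (G q.1, G q.2)).
  exact: (slopes_comp oU GU (fun i => (hGP i).1) Sf).
move=> j; apply: Ck_sum => i _; apply: CkM => //; first exact: (hGP i).2.
exact: (IH (fun y => hf i (y, y)) CG' (Df i)).
Qed.

(** By continuity of the slopes, the error f (x + v) - f x - L v is a sum of products of the
    coordinates of v with quantities that tend to 0, hence a little o of v. *)
Lemma slopes_diff m n (U : set 'rV[R]_m) (f : 'rV[R]_m -> 'rV[R]_n) h x :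
  open U -> U x -> (forall i, slopes U (fun y => f y 0 i) (h i)) ->
  differentiable f x /\
  forall v, 'd f x v = \row_i \sum_j v 0 j * h i j (x, x).
Proof.
move=> oU Ux Sf.
pose A := \matrix_(j, i) h i j (x, x).
pose L : {linear 'rV[R]_m -> 'rV[R]_n} := mulmxr A.
have Lc : continuous L by exact: continuous_mulmxr.
pose V : normedModType R := 'rV[R]_m; pose W : normedModType R := 'rV[R]_n.
have fE : (f : V -> W) \o shift (x : V) = cst (f x : W) + (L : V -> W) +o_ (0 : V) id.
  apply/eqaddoP => e e0.
  pose e' := e / m.+1%:R.
  have e'0 : 0 < e' by rewrite divr_gt0.
  have sc : {for (0 : V), continuous (fun v : V => v + x : V)}.
    by apply: continuousD; [move=> B|exact: cst_continuous].
  have FF : Filter (nbhs (0 : V)) by exact: nbhs_filter.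
  have nU : \forall v \near (0 : V), U (v + x).
    by apply: sc; rewrite /= add0r; exact: open_nbhs_nbhs.
  have nh : \forall v \near (0 : V), forall ij : 'I_n * 'I_m,
      `|h ij.1 ij.2 (x, v + x) - h ij.1 ij.2 (x, x)| < e'.
    apply: (@filter_forall _ _ _ _ FF) => -[i j] /=.
    have hc : {for (0 : V), continuous (fun v : V => h i j (x, v + x))}.
      apply: (@continuous_at_comp _ _ _ (0 : V) (fun v : V => (x : V, v + x : V)) (h i j)).
        by apply: continuous_at_pair => //; exact: cst_continuous.
      by rewrite add0r; apply: (Sf i).1.
    have := hc (ball (h i j (x, x)) e'); rewrite /= add0r => /(_ (nbhsx_ballx _ _ e'0)).
    by apply: (@filterS _ _ FF) => v; rewrite /= -ball_normE /= distrC.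
  apply: (@filterS2 _ _ FF _ _ _ _ nU nh) => v Uvx hv.
  apply: rV_norm_le => [|i]; first by rewrite mulr_ge0 // ltW.
  have := (Sf i).2 x (v + x) Ux Uvx; rewrite /= => fxv.
  rewrite !mxE /= opprD addrA fxv.
  have -> : \sum_j ((v + x) 0 j - x 0 j) * h i j (x, v + x) - \sum_j v 0 j * A j i = 
    \sum_j v 0 j * (h i j (x, v + x) - h i j (x, x)).
    by rewrite -sumrB; apply: eq_bigr => j _; rewrite !mxE addrK mulrBr.
  apply: le_trans (ler_norm_sum _ _ _) _.
  apply: (@le_trans _ _ (\sum_(j < m) e' * `|v|)).
    apply: ler_sum => j _; rewrite normrM mulrC ler_pM //.
      exact: ltW (hv (i, j)).
    exact: ler_coord_norm.
  rewrite sumr_const card_ord -mulrnAl ler_wpM2r // -mulr_natr /e' mulrAC ler_pdivrMr //.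
  by rewrite ler_wpM2l // ?ler_nat // ltW.
have dE := diff_unique Lc fE.
split.
  by apply/diff_locallyP; rewrite dE.
move=> v; rewrite dE /= /L; apply/rowP => i; rewrite !mxE; apply: eq_bigr => j _.
by rewrite mxE.
Qed.

(** One order is lost because Ck 0 does not contain continuity. *)
Lemma Ck_class_C m n k (U : set 'rV[R]_m) (f : 'rV[R]_m -> 'rV[R]_n) :
  open U -> (forall i, Ck k.+1 U (fun y => f y 0 i)) -> class_C k U f.
Proof.
move=> oU; elim: k f => [|k IH] f Cf.
  move=> x Ux; apply: continuous_at_rV => i.
  by case: (Cf i) => h Sf _; exact: (slopes_continuous oU Sf).
have /choice [h hP] : forall i, exists h, slopes U (fun x => f x 0 i) h /\
    forall j, Ck k.+1 U (fun x => h j (x, x)).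
  by move=> i; case: (Cf i) => h ? ?; exists h.
have dP x (Ux : U x) := slopes_diff oU Ux (fun i => (hP i).1).
split=> [x Ux|v]; first exact: (dP x Ux).1.
apply: IH => i.
apply: (@Ck_eq _ _ _ (fun x => \sum_j v 0 j * h i j (x, x))).
  by move=> x Ux; rewrite deriveE ?(dP x Ux).2 ?mxE //; exact: (dP x Ux).1.
apply: Ck_sum => j _; apply: CkM => //; first exact: Ck_cst.
exact: (hP i).2.
Qed.

End Slopes.

(** * The implicit function theorem and straightening *)

Section Implicit.
Variable R : realType.

Definition coord_smooth m n (U : set 'rV[R]_m) (f : 'rV[R]_m -> 'rV[R]_n) : Prop :=
  forall l i, Ck l U (fun x => f x 0 i).

Lemma coord_smooth_smooth_on m n (U : set 'rV[R]_m) (f : 'rV[R]_m -> 'rV[R]_n) :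
  open U -> coord_smooth U f -> smooth_on U f.
Proof. by move=> oU Cf l; apply: Ck_class_C => // i; exact: Cf. Qed.

(** Slopes are far from unique, but their diagonal values are partial derivatives. *)
Lemma slopes_diag_uniq m (U : set 'rV[R]_m) f h h' x j : open U -> U x ->
  slopes U f h -> slopes U f h' -> h j (x, x) = h' j (x, x).
Proof.
move=> oU Ux Sh Sh'.
pose f1 x : 'rV[R]_1 := \row_(i < 1) f x.
have S1 g : slopes U f g -> forall i, slopes U (fun y => f1 y 0 i) ((fun=> g) i).
  move=> [gc gE] i; split=> // y z Uy Uz; rewrite !mxE; exact: gE.
have [_ d1] := slopes_diff oU Ux (S1 _ Sh).
have [_ d2] := slopes_diff oU Ux (S1 _ Sh').
have := d2 (delta_mx 0 j); rewrite d1 => /rowP/(_ 0); rewrite !mxE.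
have E (g : 'I_m -> 'rV[R]_m * 'rV[R]_m -> R) :
    \sum_i (delta_mx 0 j : 'rV[R]_m) 0 i * g i (x, x) = g j (x, x).
  rewrite (bigD1 j) //= mxE !eqxx mul1r big1 ?addr0 // => i /negPf ij.
  by rewrite mxE ij andbF mul0r.
by rewrite !E.
Qed.

(** In the definition of Ck each order k comes with its own slopes.  As their diagonals
    agree, any one choice of slopes of a smooth function has smooth diagonal. *)
Lemma slopes_partial_Ck m (U : set 'rV[R]_m) f h : open U -> (forall l, Ck l U f) ->
  slopes U f h -> forall l j, Ck l U (fun x => h j (x, x)).
Proof.
move=> oU Cf Sh l j; have [h' Sh' Ch'] := Cf l.+1.
by apply: Ck_eq (Ch' j) => x Ux; exact: (slopes_diag_uniq j oU Ux Sh' Sh).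
Qed.

Definition upd n (k : 'I_n) (y : 'rV[R]_n) (t : R) : 'rV[R]_n :=
  \row_j (if j == k then t else y 0 j).

Lemma upd_eq n (k : 'I_n) y t : upd k y t 0 k = t.
Proof. by rewrite mxE eqxx. Qed.

Lemma upd_neq n (k j : 'I_n) y t : j != k -> upd k y t 0 j = y 0 j.
Proof. by rewrite mxE => /negPf ->. Qed.

Lemma upd_id n (k : 'I_n) y : upd k y (y 0 k) = y.
Proof. by apply/rowP => j; rewrite mxE; case: eqP => [->|]. Qed.

Lemma upd_upd n (k : 'I_n) y s t : upd k (upd k y s) t = upd k y t.
Proof. by apply/rowP => j; rewrite !mxE; case: eqP. Qed.

Section Straighten.
Variables (n : nat) (k : 'I_n) (F : 'rV[R]_n -> R) (H : 'I_n -> 'rV[R]_n * 'rV[R]_n -> R).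
Hypothesis FC : forall l, Ck l setT F.
Hypothesis FH : slopes setT F H.
Hypothesis F0 : F 0 = 0.
Hypothesis Hk0 : 0 < H k (0, 0).

(** By joint continuity the slopes stay close to their values at (0, 0): the k-th one is
    bounded below, all of them are bounded. *)
Lemma slope_box (O : set 'rV[R]_n) : open O -> O 0 ->
  exists e, exists m, exists K, [/\ 0 < e, 0 < m, 0 < K &
    [/\ forall x, `|x| < e -> O x,
     forall x y, `|x| < e -> `|y| < e -> m < H k (x, y) &
     forall j x y, `|x| < e -> `|y| < e -> `|H j (x, y)| <= K]].
Proof.
move=> oO O0; pose m := H k (0, 0) / 2.
have m0 : 0 < m by rewrite divr_gt0.
pose V := 'rV[R]_n : normedModType R.
have nH : nbhs ((0, 0) : V * V) [set q | forall j, ball (H j (0, 0)) m (H j q)].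
  have FF : Filter (nbhs ((0, 0) : V * V)) by exact: nbhs_filter.
  apply: (@filter_forall _ _ (fun j q => ball (H j (0, 0)) m (H j q)) _ FF) => j.
  have Hc : {for ((0, 0) : V * V), continuous (H j)} by exact: (FH.1 j 0 0 I I).
  exact: (Hc _ (nbhsx_ballx _ _ m0)).
have [e1 /= e10 eH] := (nbhs_ballP _ _).1 nH.
have [e2 /= e20 eO] := (nbhs_ballP _ _).1 (open_nbhs_nbhs (conj oO O0)).
have bE (e : R) x : `|x| < e -> ball (0 : V) e x.
  by rewrite -ball_normE /= sub0r normrN.
exists (Num.min e1 e2), m, (m + \sum_j `|H j (0, 0)|); split => //.
- by rewrite lt_min e10.
- by rewrite ltr_wpDr // sumr_ge0.
have He j x y : `|x| < Num.min e1 e2 -> `|y| < Num.min e1 e2 -> `|H j (0, 0) - H j (x, y)| < m.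
  rewrite !lt_min => /andP[x1 _] /andP[y1 _].
  by have := eH (x, y) (conj (bE _ _ x1) (bE _ _ y1)) j; rewrite -ball_normE.
split.
- by move=> x; rewrite lt_min => /andP[_ x2]; apply: eO; exact: bE.
- move=> x y xe ye; have := He k x y xe ye; rewrite ltr_norml => /andP[_].
  rewrite ltrBlDr {1}(_ : H k (0, 0) = m + m) ?ltrD2l //.
  by rewrite /m -splitr.
- move=> j x y xe ye; have := He j x y xe ye => Hj.
  rewrite -[H j (x, y)](subrK (H j (0, 0))) (le_trans (ler_normD _ _)) // lerD //.
    by rewrite distrC ltW.
  by rewrite (bigD1 j) //= lerDl sumr_ge0.
Qed.

(** On the segment in the k-th direction through a point y close to 0, the function F varies
    at least as m * t up to a small error, so it takes the value y 0 k by the intermediate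
    value theorem. *)
Lemma implicit_root (e m K : R) : 0 < e -> 0 < m -> 0 < K ->
  (forall x y, `|x| < e -> `|y| < e -> m < H k (x, y)) ->
  (forall j x y, `|x| < e -> `|y| < e -> `|H j (x, y)| <= K) ->
  exists2 d, 0 < d <= e & forall y, `|y| < d ->
    exists t, `|upd k y t| < e /\ F (upd k y t) = y 0 k.
Proof.
move=> e0 m0 K0 Hm HK.
pose r := e / 2; have r0 : 0 < r by rewrite divr_gt0.
have re : r < e by rewrite /r; lra.
pose c := r * m / 2; have c0 : 0 < c by rewrite divr_gt0 // mulr_gt0.
(* the error made by the other coordinates, at most n d K, must stay below c = r m / 2 *)
pose d := Num.min r (Num.min c (c / (n%:R * K + 1))).
have nK : 0 < n%:R * K + 1 by rewrite ltr_wpDl // mulr_ge0 // ltW.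
have d0 : 0 < d by rewrite /d !lt_min r0 c0 divr_gt0.
have dr : d <= r by rewrite /d ge_min lexx.
have dc : d <= c by rewrite /d !ge_min lexx orbT.
have dK : n%:R * (d * K) <= c.
  have : d <= c / (n%:R * K + 1) by rewrite /d !ge_min lexx !orbT.
  rewrite ler_pdivlMr // mulrDr mulr1 => h.
  by rewrite mulrCA (le_trans _ h) // lerDl ltW.
exists d; first by rewrite d0 (le_trans dr) // ltW.
move=> y yd.
have yj j : `|y 0 j| < d by exact: le_lt_trans (ler_coord_norm _ _) yd.
have updr t : `|t| <= r -> `|upd k y t| < e.
  move=> tr; apply: rV_norm_lt => // j; rewrite mxE; case: eqP => _.
    exact: le_lt_trans re.
  by rewrite (lt_trans (yj j)) // (le_lt_trans dr).
have FE t : `|t| <= r -> `|F (upd k y t) - t * H k (0, upd k y t)| <= c.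
  move=> tr; have := FH.2 0 (upd k y t) I I; rewrite F0 subr0 => ->.
  rewrite (bigD1 k) //= upd_eq mxE subr0 addrAC subrr add0r.
  apply: le_trans (ler_norm_sum _ _ _) _; apply: le_trans dK.
  apply: (@le_trans _ _ (\sum_(j < n | j != k) d * K)).
    apply: ler_sum => j jk; rewrite upd_neq // mxE subr0 normrM ler_pM //.
      exact: ltW.
    by apply: HK; rewrite ?normr0 //; exact: updr.
  have -> : n%:R * (d * K) = \sum_(j < n) d * K by rewrite sumr_const card_ord mulr_natl.
  by rewrite [leRHS](bigD1 k) //= lerDr mulr_ge0 // ltW.
have rm t : `|t| <= r -> m < H k (0, upd k y t).
  by move=> tr; apply: Hm; rewrite ?normr0 //; exact: updr.
have rr : `|r| <= r by rewrite ger0_norm // ltW.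
have rNr : `|- r| <= r by rewrite normrN.
have c2 : c + c = r * m by rewrite /c -splitr.
have Fr : c <= F (upd k y r).
  have := FE _ rr; rewrite ler_norml => /andP[+ _].
  have : r * m <= r * H k (0, upd k y r) by rewrite ler_wpM2l // ltW // rm.
  lra.
have FNr : F (upd k y (- r)) <= - c.
  have := FE _ rNr; rewrite ler_norml => /andP[_].
  have : r * m <= r * H k (0, upd k y (- r)) by rewrite ler_wpM2l // ltW // rm.
  lra.
have yk : - c <= y 0 k <= c by rewrite -ler_norml ltW // (lt_le_trans (yj k)).
have Fc : {within `[(- r), r], continuous (fun t => F (upd k y t))}.
  apply: continuous_subspaceT => t; apply: (@continuous_at_comp _ _ _ t (upd k y) F).
    apply: continuous_at_rV => j; have [->|jk] := eqVneq j k.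
      have -> : (fun t => upd k y t 0 k) = id by apply: funext => s; rewrite upd_eq.
      by move=> A.
    have -> : (fun t => upd k y t 0 j) = (fun=> y 0 j) by apply: funext => s; rewrite upd_neq.
    exact: continuous_at_cst.
  have [h Sh _] := FC 1%N; exact: (slopes_continuous openT Sh).
have Nrr : - r <= r by lra.
have FNrr : F (upd k y (- r)) <= F (upd k y r) by lra.
have [|t tr Ft] := IVT (v := y 0 k) Nrr Fc.
  by rewrite (min_idPl FNrr) (max_idPr FNrr); apply/andP; split; lra.
exists t; split=> //; apply: updr.
by move: tr; rewrite in_itv /= ler_norml.
Qed.

(** The inverse function theorem for the map that replaces the k-th coordinate by F.  Its
    inverse only modifies the k-th coordinate, by an implicit function g.  Solving the slope
    identity of F for the increment of g gives slopes of g in terms of those of F and of g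
    itself: they make g Lipschitz, then continuous, then C^l for every l by induction. *)
Lemma straighten_core (O : set 'rV[R]_n) : open O -> O 0 ->
  exists (U W : set 'rV[R]_n) (phi psi : 'rV[R]_n -> 'rV[R]_n),
    [/\ [/\ open U, open W, U 0, U `<=` O &
      coord_smooth U phi /\ coord_smooth W psi],
    [/\ forall x, U x -> W (phi x), forall y, W y -> U (psi y),
          forall x, U x -> psi (phi x) = x & forall y, W y -> phi (psi y) = y] &
    forall x, phi x = upd k x (F x)].
Proof.
move=> oO O0; have [e [m [K [e0 m0 K0 [eO Hm HK]]]]] := slope_box oO O0.
have [d /andP[d0 de] root] := implicit_root e0 m0 K0 Hm HK.
have sub_root y s t : `|upd k y s| < e -> `|upd k y t| < e ->
    F (upd k y s) = F (upd k y t) -> s = t.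
  move=> ys yt Fst; have := FH.2 (upd k y t) (upd k y s) I I.
  rewrite Fst subrr (bigD1 k) //= !upd_eq big1 => [|j jk]; last first.
    by rewrite !upd_neq // subrr mul0r.
  rewrite addr0 => /esym/eqP; rewrite mulf_eq0 subr_eq0 => /orP[/eqP //|].
  by rewrite gt_eqF // (lt_trans m0) // Hm.
have /choice [g gP] : forall y, exists t, `|y| < d -> `|upd k y t| < e /\ F (upd k y t) = y 0 k.
  move=> y; have [yd|_] := boolP (`|y| < d); last by exists 0.
  by have [t tP] := root y yd; exists t.
pose phi x := upd k x (F x); pose psi y := upd k y (g y).
pose W : set 'rV[R]_n := ball 0 d; pose E : set 'rV[R]_n := ball 0 e.
have WE y : W y <-> `|y| < d by rewrite /W -ball_normE /= sub0r normrN.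
have EE y : E y <-> `|y| < e by rewrite /E -ball_normE /= sub0r normrN.
pose U := E `&` phi @^-1` W.
have psiE y : W y -> `|psi y| < e by move=> /WE/gP[].
have psiF y : W y -> F (psi y) = y 0 k by move=> /WE/gP[].
have oW : open W by exact: ball_open.
have phiC : coord_smooth setT phi.
  move=> l i; have [->|ik] := eqVneq i k.
    by apply: Ck_eq (FC l) => x _; rewrite upd_eq.
  by apply: Ck_eq (Ck_coord l setT i) => x _; rewrite upd_neq.
have phic : continuous phi.
  move=> x; apply: continuous_at_rV => i; have [h Sh _] := phiC 1%N i.
  exact: (slopes_continuous openT Sh).
have oU : open U by apply: openI; [exact: ball_open|apply: open_comp => // x _; exact: phic].
have phi_psi y : W y -> phi (psi y) = y.
  by move=> Wy; rewrite /phi psiF // /psi upd_upd upd_id.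
(* the slope identity of F between psi x and psi y, solved for g y - g x *)
pose G j q := (if j == k then 1 else - H j (psi q.1, psi q.2)) / H k (psi q.1, psi q.2).
have GE x y : W x -> W y -> g y - g x = \sum_j (y 0 j - x 0 j) * G j (x, y).
  move=> Wx Wy; have Hk : H k (psi x, psi y) != 0.
    by rewrite gt_eqF // (lt_trans m0) // Hm //; exact: psiE.
  have := FH.2 (psi x) (psi y) I I; rewrite !psiF //.
  rewrite (bigD1 k) //= !upd_eq => Fxy.
  rewrite (bigD1 k) //= /G eqxx /= Fxy.
  under [X in _ = _ + X]eq_bigr => j /negPf jk do rewrite jk mulrA mulrN mulNr.
  have -> : \sum_(j < n | j != k) - ((y 0 j - x 0 j) * H j (psi x, psi y) / H k (psi x, psi y)) =
     - ((\sum_(j < n | j != k) (psi y 0 j - psi x 0 j) * H j (psi x, psi y)) / H k (psi x, psi y)).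
    rewrite sumrN mulr_suml; congr (- _); apply: eq_bigr => j jk.
    by rewrite !upd_neq.
  by field.
pose V := 'rV[R]_n : normedModType R.
have gcont y : W y -> {for y, continuous g}.
  move=> Wy.
  pose C := n%:R * ((1 + K) / m).
  have C0 : 0 <= C by rewrite mulr_ge0 // divr_ge0 ?ltW // addr_gt0.
  have lip z : W z -> `|g y - g z| <= C * `|y - z|.
    move=> Wz; rewrite distrC GE //; apply: le_trans (ler_norm_sum _ _ _) _.
    have -> : C * `|y - z| = \sum_(j < n) `|y - z| * ((1 + K) / m).
      by rewrite sumr_const card_ord /C -mulr_natl; ring.
    apply: ler_sum => j _; rewrite normrM ler_pM //.
      by rewrite distrC; have := ler_coord_norm (y - z) j; rewrite !mxE.
    have Hk := Hm _ _ (psiE _ Wy) (psiE _ Wz).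
    rewrite /G /= normrM ler_pM //.
      case: (j == k); first by rewrite normr1 lerDl ltW.
      by rewrite normrN (le_trans (HK _ _ _ (psiE _ Wy) (psiE _ Wz))) // lerDr.
    rewrite normfV lef_pV2 ?posrE //; last by rewrite normr_gt0 gt_eqF // (lt_trans m0).
    by rewrite ger0_norm ltW // (lt_trans m0).
  have FF : Filter (nbhs (y : V)) by exact: nbhs_filter.
  apply/cvgrPdist_le => eps eps0.
  have n1 : nbhs (y : V) W by exact: open_nbhs_nbhs.
  have eC : 0 < eps / (C + 1) by rewrite divr_gt0 // ltr_wpDl.
  have n2 := nbhsx_ballx (y : V) _ eC.
  apply: (@filterS2 _ _ FF _ _ _ _ n1 n2) => z Wz; rewrite -ball_normE /= => yz.
  apply: le_trans (lip _ Wz) _; apply: (@le_trans _ _ (C * (eps / (C + 1)))).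
    by rewrite ler_wpM2l // ltW.
  have C1 : 0 < C + 1 by rewrite ltr_wpDl.
  by rewrite mulrCA ler_piMr ?(ltW eps0) // ler_pdivrMr // mul1r lerDl.
have psic y : W y -> {for y, continuous psi}.
  move=> Wy; apply: continuous_at_rV => i; have [->|ik] := eqVneq i k.
    have -> : (fun y => psi y 0 k) = g by apply: funext => z; rewrite upd_eq.
    exact: gcont.
  have -> : (fun y => psi y 0 i) = (fun y => y 0 i) by apply: funext => z; rewrite upd_neq.
  exact: coord_continuous.
have Sg : slopes W g G.
  split; last exact: GE.
  move=> j x y Wx Wy.
  have psi2 : {for (x, y), continuous (fun q : 'rV[R]_n * 'rV[R]_n => (psi q.1, psi q.2))}.
    apply: continuous_at_pair.
      by apply: continuous_at_fst; exact: psic.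
    by apply: continuous_at_snd; exact: psic.
  have Hc i : {for (x, y), continuous (fun q : 'rV[R]_n * 'rV[R]_n => H i (psi q.1, psi q.2))}.
    by apply: (continuous_at_comp psi2); apply: FH.1.
  apply: continuousM; last first.
    apply: continuousV => //=; rewrite gt_eqF // (lt_trans m0) // Hm //; exact: psiE.
  case: (j == k); first exact: continuous_at_cst.
  by apply: continuousN; exact: Hc.
have gC l : Ck l W g.
  elim: l => [//|l IH]; exists G => // j.
  have psiC i : Ck l W (fun x => psi x 0 i).
    have [->|ik] := eqVneq i k.
      by apply: Ck_eq IH => x _; rewrite upd_eq.
    by apply: Ck_eq (Ck_coord l W i) => x _; rewrite upd_neq.
  have HC i : Ck l W (fun x => H i (psi x, psi x)).
    apply: (@Ck_comp _ _ _ l W setT psi (fun x => H i (x, x))) => //.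
    exact: slopes_partial_Ck openT FC FH l i.
  apply: CkM => //; last first.
    apply: CkV => // x Wx; rewrite gt_eqF // (lt_trans m0) // Hm //; exact: psiE.
  case: (j == k) => /=; first exact: Ck_cst.
  apply: (@Ck_eq _ _ _ _ (fun x => -1 * H j (psi x, psi x))); first by move=> x _; rewrite mulN1r.
  by apply: CkM => //; exact: Ck_cst.
exists U, W, phi, psi; split.
- split=> //.
  + split; first by apply/EE; rewrite normr0.
    apply/WE; rewrite /phi F0 (_ : upd k 0 0 = 0) ?normr0 //.
    by apply/rowP => j; rewrite !mxE if_same.
  + by move=> x [/EE/eO].
  + split; first by move=> l i; apply: Ck_sub (phiC l i).
    move=> l i; have [->|ik] := eqVneq i k.
      by apply: Ck_eq (gC l) => x _; rewrite upd_eq.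
    by apply: Ck_eq (Ck_coord l W i) => x _; rewrite upd_neq.
- split=> //.
  + by move=> x [].
  + by move=> y Wy; split; [apply/EE/psiE|rewrite /= phi_psi].
  + move=> x [/EE xe Wx]; rewrite /psi /phi upd_upd.
    suff -> : g (upd k x (F x)) = x 0 k by rewrite upd_id.
    have := gP _ ((WE _).1 Wx); rewrite /phi upd_upd upd_eq => -[ge gF].
    by apply: (sub_root x) => //; rewrite upd_id.
- by [].
Qed.

End Straighten.

Lemma slopesN m (U : set 'rV[R]_m) f h : slopes U f h ->
  slopes U (fun x => - f x) (fun j q => - h j q).
Proof.
move=> [hc hE]; split=> [j x y Ux Uy|x y Ux Uy]; first by apply: continuousN; exact: hc.
by under eq_bigr do rewrite mulrN; rewrite sumrN -hE // opprB opprK addrC.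
Qed.

Lemma CkN m k (U : set 'rV[R]_m) f : Ck k U f -> Ck k U (fun x => - f x).
Proof.
elim: k f => [//|k IH] f [h Sh Ch]; exists (fun j q => - h j q); first exact: slopesN.
by move=> j; exact: (IH _ (Ch j)).
Qed.

Lemma slopes_affine m n (U : set 'rV[R]_m) (p : 'rV[R]_n) (B : 'M[R]_(m, n)) i :
  slopes U (fun y => (p + y *m B) 0 i) (fun j _ => B j i).
Proof.
split=> [j x y _ _|x y _ _]; first exact: continuous_at_cst.
by rewrite !mxE opprD addrACA subrr add0r -sumrB; apply: eq_bigr => j _; rewrite mulrBl.
Qed.

Lemma affine_smooth m n (U : set 'rV[R]_m) (p : 'rV[R]_n) (B : 'M[R]_(m, n)) :
  coord_smooth U (fun y => p + y *m B).
Proof.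
move=> [//|l] i; exists (fun j _ => B j i); first exact: slopes_affine.
by move=> j; exact: Ck_cst.
Qed.

Lemma coord_smooth_comp m n q (U : set 'rV[R]_m) (U' : set 'rV[R]_n)
    (G : 'rV[R]_m -> 'rV[R]_n) (f : 'rV[R]_n -> 'rV[R]_q) :
  open U -> (forall x, U x -> U' (G x)) ->
  coord_smooth U G -> coord_smooth U' f -> coord_smooth U (fun x => f (G x)).
Proof.
move=> oU GU CG Cf l i.
exact: (@Ck_comp _ _ _ l U U' G (fun y => f y 0 i) oU GU (CG l) (Cf l i)).
Qed.

Lemma continuous_affine m n (p : 'rV[R]_n) (B : 'M[R]_(m, n)) :
  continuous (fun y : 'rV[R]_m => p + y *m B).
Proof.
move=> x; apply: continuous_at_rV => i.
exact: (slopes_continuous openT (slopes_affine setT p B i) I).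
Qed.

(** A regular equation f = 0 together with linear equations: in the affine coordinates
    given by the rows of B, the k-th coordinate is traded for f, which is possible as soon as
    the derivative of f along the k-th row of B does not vanish. *)
Lemma straighten_affine n (k : 'I_n) (B : 'M[R]_n) (p : 'rV[R]_n) f h (O : set 'rV[R]_n) :
  B \in unitmx -> open O -> O p -> (forall l, Ck l setT f) -> slopes setT f h ->
  f p = 0 -> \sum_j B k j * h j (p, p) != 0 ->
  exists (U W : set 'rV[R]_n) (phi psi : 'rV[R]_n -> 'rV[R]_n),
    [/\ diffeomorphism U W phi psi, U p, U `<=` O &
      forall x, (phi x 0 k = 0 <-> f x = 0) /\
        forall j, j != k -> phi x 0 j = ((x - p) *m invmx B) 0 j].
Proof.
move=> Bu oO Op Cf Sf fp0 df0.
pose A : 'rV[R]_n -> 'rV[R]_n := fun y => p + y *m B.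
pose A' : 'rV[R]_n -> 'rV[R]_n := fun x => (x - p) *m invmx B.
have A'E x : A' x = - p *m invmx B + x *m invmx B by rewrite /A' mulmxBl mulNmx addrC.
have A'K x : A (A' x) = x by rewrite /A /A' mulmxKV // addrC subrK.
have AK y : A' (A y) = y by rewrite /A /A' addrC addKr mulmxK.
have A0 : A 0 = p by rewrite /A mul0mx addr0.
have Ac : continuous A by exact: continuous_affine.
have A'c : continuous A'.
  rewrite (_ : A' = fun x => - p *m invmx B + x *m invmx B); last exact: funext.
  exact: continuous_affine.
have AC U : coord_smooth U A by exact: affine_smooth.
have A'C U : coord_smooth U A'.
  rewrite (_ : A' = fun x => - p *m invmx B + x *m invmx B); last exact: funext.
  exact: affine_smooth.
pose h' j q := \sum_i B j i * h i (A q.1, A q.2).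
have Sf' : slopes setT (fun y => f (A y)) h'.
  have := slopes_comp openT (fun x (_ : setT x) => I) (slopes_affine setT p B) Sf.
  by [].
have Cf' l : Ck l setT (fun y => f (A y)).
  exact: (@Ck_comp _ _ _ l setT setT A f openT (fun _ _ => I) (AC setT l) (Cf l)).
have oAO : open (A @^-1` O) by apply: open_comp => // x _; exact: Ac.
have fA0 : f (A 0) = 0 by rewrite A0.
have h'0 : h' k (0, 0) != 0 by rewrite /h' /= A0.
(* the sign of f is chosen so that the k-th slope is positive at the origin *)
have [F [H [FC FH F0 Hk0 FE]]] : exists F H, [/\ forall l, Ck l setT F, slopes setT F H,
    F 0 = 0, 0 < H k (0, 0) & forall y, F y = 0 <-> f (A y) = 0].
  move: h'0; rewrite neq_lt => /orP[hn|hp].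
    exists (fun y => - f (A y)), (fun j q => - h' j q); split.
    - by move=> l; exact: CkN.
    - exact: slopesN.
    - by rewrite fA0 oppr0.
    - by rewrite oppr_gt0.
    - by move=> y; split=> [/eqP|->]; rewrite ?oppr0 // oppr_eq0 => /eqP.
  by exists (fun y => f (A y)), h'; split.
have AO0 : (A @^-1` O) 0 by rewrite /= A0.
have [U [W [phi [psi [[oU oW U0 UO [phiC psiC]] [phiW psiU phiK psiK] phiE]]]]] :=
  straighten_core FC FH F0 Hk0 oAO AO0.
have oU' : open (A' @^-1` U) by apply: open_comp => // x _; exact: A'c.
exists (A' @^-1` U), W, (fun x => phi (A' x)), (fun y => A (psi y)); split.
- split=> //.
  + by apply: coord_smooth_smooth_on => //; apply: (coord_smooth_comp oU' _ (A'C _) phiC).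
  + by apply: coord_smooth_smooth_on => //; apply: (coord_smooth_comp oW _ psiC (AC U)).
  + split.
    * by move=> x; exact: phiW.
    * by move=> y Wy /=; rewrite AK; exact: psiU.
    * by move=> x Ux; rewrite phiK.
    * by move=> y Wy; rewrite AK psiK.
- by rewrite /= -A0 AK.
- by move=> x /= /UO /=; rewrite A'K.
- move=> x; rewrite phiE; split; last by move=> j jk; rewrite upd_neq.
  by rewrite upd_eq FE A'K.
Qed.

End Implicit.

(** * Minors and real cross-ratios *)

Definition o0 : 'I_4 := @Ordinal 4 0 isT.
Definition o1 : 'I_4 := @Ordinal 4 1 isT.
Definition o2 : 'I_4 := @Ordinal 4 2 isT.
Definition o3 : 'I_4 := @Ordinal 4 3 isT.

Lemma sum4 (V : nmodType) (f : 'I_4 -> V) : \sum_j f j = f o0 + f o1 + f o2 + f o3.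
Proof.
by rewrite !big_ord_recr big_ord0 /= add0r; congr (_ + _ + _ + _); congr f; exact: val_inj.
Qed.

Lemma forall4 (P : 'I_4 -> Prop) : P o0 -> P o1 -> P o2 -> P o3 -> forall j, P j.
Proof.
move=> P0 P1 P2 P3 [[|[|[|[|//]]]] lt]; [move: P0|move: P1|move: P2|move: P3];
  by congr P; exact: val_inj.
Qed.

Section Plucker.
Variable R : realType.
Local Notation C := R[i].
Implicit Types (D : 'M[C]_(2, 4)) (a z : 'rV[C]_4).

Definition minor2 D (i j : 'I_4) : C := D 0 i * D 1 j - D 0 j * D 1 i.

(** The 3 x 3 minor, on the columns i, j, k, of the matrix with rows a, D 0, D 1. *)
Definition minor3 a D (i j k : 'I_4) : C :=
  a 0 i * minor2 D j k - a 0 j * minor2 D i k + a 0 k * minor2 D i j.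

Let rcM (u v : R) : (u * v)%:C = u%:C * v%:C. Proof. exact: rmorphM. Qed.
Let rcD (u v : R) : (u + v)%:C = u%:C + v%:C. Proof. exact: rmorphD. Qed.
Let rcB (u v : R) : (u - v)%:C = u%:C - v%:C. Proof. exact: rmorphB. Qed.
Let conjM (u v : C) : conjc (u * v) = conjc u * conjc v. Proof. exact: rmorphM. Qed.

Lemma conj_Im0 (x : C) : conjc x = x -> Im x = 0.
Proof. by case: x => a b [] /= ?; lra. Qed.

Let ImZ (u : R) (v : C) : Im (u%:C * v) = u * Im v.
Proof. by case: v => a b /=; rewrite mul0r addr0. Qed.

(** Both x and y are real multiples of w / d, so x * conj y is a real multiple of a squared
    modulus. *)
Lemma Im_real_ratio (x y w d : C) (r s : R) : d != 0 ->
  d * x = w * r%:C -> d * y = w * s%:C -> Im (x * conjc y) = 0.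
Proof.
move=> d0 dx dy; apply: conj_Im0.
have xE : x = d^-1 * (w * r%:C) by rewrite -dx mulKf.
have yE : y = d^-1 * (w * s%:C) by rewrite -dy mulKf.
by rewrite xE yE !conjM !conjc_inv !conjc_real !conjcK; ring.
Qed.

(** If two independent real multiples of z lie in the row space of D, they span it, and then
    a 2 x 2 minor of D is the product of two coordinates of z by a real number, up to a common
    factor.  The same holds for the 3 x 3 minors, and the coordinates of z cancel in the
    cross-ratio below, which becomes real. *)
Lemma real_span_cross_ratio z D (r r' : 'I_4 -> R) (s s' : 'I_2 -> C) k b :
  (forall j, z 0 j != 0) ->
  (forall j, (r j)%:C * z 0 j = s 0 * D 0 j + s 1 * D 1 j) ->
  (forall j, (r' j)%:C * z 0 j = s' 0 * D 0 j + s' 1 * D 1 j) ->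
  r k * r' b != r b * r' k ->
  Im (minor2 D o2 o3 * minor3 z D o0 o1 o3 * conjc (minor2 D o1 o3 * minor3 z D o0 o2 o3)) = 0.
Proof.
move=> z0 rz rz' rkb.
pose d := s 0 * s' 1 - s 1 * s' 0.
pose rho i j := r i * r' j - r j * r' i.
have m2 i j : d * minor2 D i j = z 0 i * z 0 j * (rho i j)%:C.
  transitivity (((r i)%:C * z 0 i) * ((r' j)%:C * z 0 j) -
                ((r j)%:C * z 0 j) * ((r' i)%:C * z 0 i)).
    by rewrite !rz !rz' /d /minor2; ring.
  by rewrite /rho rcB !rcM; ring.
have m3 i j l : d * minor3 z D i j l = z 0 i * z 0 j * z 0 l * (rho j l - rho i l + rho i j)%:C.
  transitivity (z 0 i * (d * minor2 D j l) - z 0 j * (d * minor2 D i l) +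
                z 0 l * (d * minor2 D i j)).
    by rewrite /minor3; ring.
  by rewrite !m2 (rcD (rho j l - rho i l)) (rcB (rho j l)); ring.
have d0 : d != 0.
  apply: contraNneq rkb => d0; have /eqP := m2 k b.
  rewrite d0 mul0r eq_sym !mulf_eq0 !(negPf (z0 _)) /=.
  by rewrite (inj_eq (@complexI R) _ 0) subr_eq0.
apply: (@Im_real_ratio _ _ (z 0 o0 * z 0 o1 * z 0 o2 * z 0 o3 * z 0 o3) (d * d)
  (rho o2 o3 * (rho o1 o3 - rho o0 o3 + rho o0 o1))
  (rho o1 o3 * (rho o2 o3 - rho o0 o3 + rho o0 o2))).
- by rewrite mulf_neq0.
- by rewrite mulrACA m2 m3 rcM; ring.
- by rewrite mulrACA m2 m3 rcM; ring.
Qed.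

(** Here r z is a vector of the row space of D, and three of the r_j have the same value c.
    Then c z agrees with this vector on three columns, which kills c times a minor of
    (z, D) on these columns; so c = 0, and a vector of the row space with three zero
    coordinates vanishes when a 2 x 2 minor on them does not. *)
Lemma three_equal z D (r : 'I_4 -> R) (s : 'I_2 -> C) i j l m :
  (forall j, z 0 j != 0) ->
  (forall j, (r j)%:C * z 0 j = s 0 * D 0 j + s 1 * D 1 j) ->
  minor2 D i j != 0 -> minor3 z D i j l != 0 ->
  r i = r j -> r i = r l -> [/\ r i = 0, r j = 0, r l = 0 & r m = 0].
Proof.
move=> z0 rz mij mijl rij ril.
have k0 : r i = 0.
  have : (r i)%:C * minor3 z D i j l = 0.
    transitivity (((r i)%:C * z 0 i) * minor2 D j l - ((r i)%:C * z 0 j) * minor2 D i l +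
                  ((r i)%:C * z 0 l) * minor2 D i j).
      by rewrite /minor3; ring.
    rewrite {2}rij {2}ril !rz /minor2; ring.
  by move/eqP; rewrite mulf_eq0 (negPf mijl) orbF => /eqP/complexI.
have rj0 : r j = 0 by rewrite -rij.
have e1 := rz i; have e2 := rz j.
rewrite k0 mul0r in e1; rewrite rj0 mul0r in e2.
have s0 : s 0 = 0.
  have : s 0 * minor2 D i j = 0.
    transitivity ((s 0 * D 0 i + s 1 * D 1 i) * D 1 j - (s 0 * D 0 j + s 1 * D 1 j) * D 1 i).
      by rewrite /minor2; ring.
    by rewrite -e1 -e2; ring.
  by move/eqP; rewrite mulf_eq0 (negPf mij) orbF => /eqP.
have s1 : s 1 = 0.
  have : s 1 * minor2 D i j = 0.
    transitivity ((s 0 * D 0 j + s 1 * D 1 j) * D 0 i - (s 0 * D 0 i + s 1 * D 1 i) * D 0 j).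
      by rewrite /minor2; ring.
    by rewrite -e1 -e2; ring.
  by move/eqP; rewrite mulf_eq0 (negPf mij) orbF => /eqP.
split=> //; first by rewrite -ril.
have /eqP := rz m; rewrite s0 s1 !mul0r addr0 mulf_eq0 (negPf (z0 m)) orbF.
by move=> /eqP/complexI.
Qed.

(** Put al_j = lam_j conj z_j.  The linear forms with coefficients al_j and r_j al_j both
    vanish on the row space of D.  Eliminating a coordinate between them gives relations with real
    coefficients between the minors of D, hence a real cross-ratio of the four coordinate
    forms, except in degenerate cases where three of the r_j coincide or al = 0. *)
Lemma real_annihilators z D (r lam : 'I_4 -> R) (s : 'I_2 -> C) :
  (forall j, z 0 j != 0) ->
  (forall j, (r j)%:C * z 0 j = s 0 * D 0 j + s 1 * D 1 j) ->
  (forall e, \sum_j (lam j)%:C * conjc (z 0 j) * D e j = 0) ->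
  (forall e, \sum_j (r j * lam j)%:C * conjc (z 0 j) * D e j = 0) ->
  Im (minor2 D o0 o1 * minor2 D o2 o3 * conjc (minor2 D o0 o2 * minor2 D o1 o3)) != 0 ->
  minor3 z D o0 o1 o2 != 0 -> minor3 z D o0 o1 o3 != 0 ->
  minor3 z D o0 o2 o3 != 0 -> minor3 z D o1 o2 o3 != 0 ->
  (forall j, r j = 0) \/ (forall j, lam j = 0).
Proof.
move=> z0 rz alD ralD G2 q3 q2 q1 q0.
have [p01 p23 p02 p13] : [/\ minor2 D o0 o1 != 0, minor2 D o2 o3 != 0,
    minor2 D o0 o2 != 0 & minor2 D o1 o3 != 0].
  by split; apply: contraNneq G2 => ->; rewrite ?rmorphM ?(mul0r, mulr0, rmorph0).
have G2' (x y : R) : x%:C * (minor2 D o0 o1 * minor2 D o2 o3) =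
   y%:C * (minor2 D o0 o2 * minor2 D o1 o3) -> x = 0 /\ y = 0.
  set A := _ o0 o1 * _; set B := _ o0 o2 * _ => AB.
  have B0 : B != 0 by rewrite mulf_neq0.
  have x0 : x = 0.
    have : x * Im (A * conjc B) = y * Im (B * conjc B).
      by rewrite -!ImZ (mulrA x%:C) AB -mulrA.
    rewrite (@conj_Im0 (B * conjc B)) ?mulr0; last by rewrite conjM conjcK mulrC.
    by move/eqP; rewrite mulf_eq0 (negPf G2) orbF => /eqP.
  split=> //; move/eqP: AB; rewrite x0 mul0r eq_sym mulf_eq0 (negPf B0) orbF.
  by move=> /eqP/complexI.
pose al j := (lam j)%:C * conjc (z 0 j).
have al0 j : (al j == 0) = (lam j == 0).
  by rewrite mulf_eq0 conjc_eq0 (negPf (z0 j)) orbF (inj_eq (@complexI R) _ 0).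
have A e : al o0 * D e o0 + al o1 * D e o1 + al o2 * D e o2 + al o3 * D e o3 = 0.
  by rewrite -(alD e) sum4.
have B e : (r o0)%:C * al o0 * D e o0 + (r o1)%:C * al o1 * D e o1
    + (r o2)%:C * al o2 * D e o2 + (r o3)%:C * al o3 * D e o3 = 0.
  by rewrite -(ralD e) sum4 /al !rcM; ring.
(* subtracting r_0 times the first form from the second removes column 0; what remains
   on the rows of D is combined to remove column 3 as well *)
have E0 : al o1 * (r o1 - r o0)%:C * minor2 D o1 o3 = - (al o2 * (r o2 - r o0)%:C * minor2 D o2 o3).
  have H e := congr2 (fun x y => x - (r o0)%:C * y) (B e) (A e).
  have := congr2 (fun x y => x * D 1 o3 - y * D 0 o3) (H 0) (H 1).
  rewrite /= !(mulr0, mul0r, subr0) => h; apply/eqP; rewrite -subr_eq0 opprK; apply/eqP.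
  by rewrite -h !rcB /minor2; ring.
(* the same with column 3 and then column 0 *)
have E3 : al o1 * (r o1 - r o3)%:C * minor2 D o0 o1 = - (al o2 * (r o2 - r o3)%:C * minor2 D o0 o2).
  have H e := congr2 (fun x y => (r o3)%:C * y - x) (B e) (A e).
  have := congr2 (fun x y => x * D 1 o0 - y * D 0 o0) (H 0) (H 1).
  rewrite /= !(mulr0, mul0r, subr0) => h; apply/eqP; rewrite -subr_eq0 opprK; apply/eqP.
  by rewrite -h !rcB /minor2; ring.
have L : [\/ r o0 = r o1 /\ r o0 = r o2, r o0 = r o1 /\ r o0 = r o3,
    r o0 = r o2 /\ r o0 = r o3 | r o1 = r o2 /\ r o1 = r o3] -> forall j, r j = 0.
  case=> -[e1 e2].
  - have [] := three_equal o3 z0 rz p01 q3 e1 e2; exact: forall4.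
  - have [a b c d] := three_equal o2 z0 rz p01 q2 e1 e2; exact: forall4.
  - have [a b c d] := three_equal o1 z0 rz p02 q1 e1 e2; exact: forall4.
  - have q0' : minor3 z D o1 o3 o2 != 0.
      apply: contraNneq q0 => q0; rewrite -oppr_eq0 -[X in _ == X]q0; apply/eqP.
      by rewrite /minor3 /minor2; ring.
    have [a b c d] := three_equal o0 z0 rz p13 q0' e2 e1; exact: forall4.
(* if it vanished, the Plucker relation would make the cross-ratio equal to 1 *)
have p03 : minor2 D o0 o3 != 0.
  apply/eqP => p03.
  have : 1%:C * (minor2 D o0 o1 * minor2 D o2 o3) = 1%:C * (minor2 D o0 o2 * minor2 D o1 o3).
    apply/eqP; rewrite -subr_eq0; apply/eqP.
    rewrite (_ : _ - _ = - (1%:C * minor2 D o0 o3 * minor2 D o1 o2)); last by rewrite /minor2; ring.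
    by rewrite p03 mulr0 mul0r oppr0.
  by move=> /G2' [] /eqP; rewrite oner_eq0.
have [l1|l1] := eqVneq (lam o1) 0; have [l2|l2] := eqVneq (lam o2) 0.
- right; have a1 : al o1 = 0 by rewrite /al l1 mul0r.
  have a2 : al o2 = 0 by rewrite /al l2 mul0r.
  have a0 : al o0 = 0.
    have : al o0 * minor2 D o0 o3 = 0.
      have := congr2 (fun x y => x * D 1 o3 - y * D 0 o3) (A 0) (A 1).
      rewrite /= !mul0r subr0 => <-; rewrite a1 a2 /minor2; ring.
    by move/eqP; rewrite mulf_eq0 (negPf p03) orbF => /eqP.
  have a3 : al o3 = 0.
    have : al o3 * minor2 D o0 o3 = 0.
      have := congr2 (fun x y => y * D 0 o0 - x * D 1 o0) (A 0) (A 1).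
      rewrite /= !mul0r subr0 => <-; rewrite a1 a2 /minor2; ring.
    by move/eqP; rewrite mulf_eq0 (negPf p03) orbF => /eqP.
  by apply: forall4 => //; apply/eqP; rewrite -al0; apply/eqP.
- left; apply: L.
  move: E0 E3; rewrite [al o1]/al l1 !mul0r => /eqP.
  rewrite eq_sym oppr_eq0 mulf_eq0 (negPf p23) orbF.
  rewrite mulf_eq0 al0 (negPf l2) /= (inj_eq (@complexI R) _ 0) subr_eq0 => /eqP r20.
  move=> /eqP; rewrite eq_sym oppr_eq0 mulf_eq0 (negPf p02) orbF.
  rewrite mulf_eq0 al0 (negPf l2) /= (inj_eq (@complexI R) _ 0) subr_eq0 => /eqP r23.
  by apply: Or43; rewrite -r20.
- left; apply: L.
  move: E0 E3; rewrite [al o2]/al l2 !mul0r oppr0 => /eqP; rewrite mulf_eq0 (negPf p13) orbF.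
  rewrite mulf_eq0 al0 (negPf l1) /= (inj_eq (@complexI R) _ 0) subr_eq0 => /eqP r10.
  move=> /eqP; rewrite mulf_eq0 (negPf p01) orbF.
  rewrite mulf_eq0 al0 (negPf l1) /= (inj_eq (@complexI R) _ 0) subr_eq0 => /eqP r13.
  by apply: Or42; rewrite -r10.
left; apply: L.
have [] := G2' ((r o1 - r o3) * (r o2 - r o0)) ((r o1 - r o0) * (r o2 - r o3)).
  have a12 : al o1 * al o2 != 0 by rewrite mulf_neq0 // al0.
  apply: (mulfI a12).
  have := congr2 *%R E0 (esym E3); rewrite !rcM => h.
  apply/eqP; rewrite -subr_eq0; apply/eqP.
  have /eqP := h; rewrite -subr_eq0 => /eqP h'.
  rewrite -[RHS]h'; ring.
move=> /eqP; rewrite mulf_eq0 !subr_eq0 => /orP[]/eqP e1 /eqP;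
  rewrite mulf_eq0 !subr_eq0 => /orP[]/eqP e2.
- by apply: Or42; rewrite -e2.
- by apply: Or44; rewrite e1 -e2.
- by apply: Or41; rewrite e2 e1.
- by apply: Or43; rewrite -e2 e1.
Qed.

End Plucker.

(** * Gradients and the determinant *)

Section Grad.
Variable R : realType.

(** Derivatives are read on the diagonal, where slopes do not depend on choices. *)
Definition grad m (U : set 'rV[R]_m) (f : 'rV[R]_m -> R) (g : 'I_m -> 'rV[R]_m -> R) :=
  exists2 h, slopes U f h & forall j x, h j (x, x) = g j x.

Lemma grad_eq m (U : set 'rV[R]_m) f f' g g' : grad U f g ->
  (forall x, U x -> f x = f' x) -> (forall j x, g j x = g' j x) -> grad U f' g'.
Proof.
move=> [h [hc hE] hg] ff gg; exists h; last by move=> j x; rewrite hg gg.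
by split=> // x y Ux Uy; rewrite -!ff // hE.
Qed.

Lemma grad_cst m (U : set 'rV[R]_m) c : grad U (fun=> c) (fun _ _ => 0).
Proof.
by exists (fun _ _ => 0) => //; exact: slopes_cst.
Qed.

Lemma grad_coord m (U : set 'rV[R]_m) i : grad U (fun x => x 0 i) (fun j _ => (j == i)%:R).
Proof.
by exists (fun j _ => (j == i)%:R) => //; exact: slopes_coord.
Qed.

Lemma gradD m (U : set 'rV[R]_m) f f' g g' : grad U f g -> grad U f' g' ->
  grad U (fun x => f x + f' x) (fun j x => g j x + g' j x).
Proof.
move=> [h Sh hg] [h' Sh' hg']; exists (fun j q => h j q + h' j q); first exact: slopesD.
by move=> j x; rewrite hg hg'.
Qed.

Lemma gradM m (U : set 'rV[R]_m) f f' g g' : open U -> grad U f g -> grad U f' g' ->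
  grad U (fun x => f x * f' x) (fun j x => g j x * f' x + f x * g' j x).
Proof.
move=> oU [h Sh hg] [h' Sh' hg'].
exists (fun j q => h j q * f' q.2 + f q.1 * h' j q); first exact: slopesM.
by move=> j x; rewrite hg hg'.
Qed.

Lemma gradV m (U : set 'rV[R]_m) f g : open U -> (forall x, U x -> f x != 0) ->
  grad U f g -> grad U (fun x => (f x)^-1) (fun j x => - g j x / (f x * f x)).
Proof.
move=> oU f0 [h Sh hg].
exists (fun j q => - h j q * ((f q.1)^-1 * (f q.2)^-1)); first exact: slopesV.
by move=> j x; rewrite hg invfM.
Qed.

Lemma grad_sum m (U : set 'rV[R]_m) (I : Type) (s : seq I) (f : I -> 'rV[R]_m -> R) g :
  (forall i, grad U (f i) (g i)) ->
  grad U (fun x => \sum_(i <- s) f i x) (fun j x => \sum_(i <- s) g i j x).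
Proof.
move=> fg; elim: s => [|i s IH].
  by apply: grad_eq (grad_cst U 0) _ _ => [x _|j x]; rewrite big_nil.
by apply: grad_eq (gradD (fg i) IH) _ _ => [x _|j x]; rewrite big_cons.
Qed.

Lemma grad_prod m (U : set 'rV[R]_m) n (f : 'I_n -> 'rV[R]_m -> R) g :
  open U -> (forall i, grad U (f i) (g i)) ->
  grad U (fun x => \prod_i f i x)
    (fun j x => \sum_k \prod_i (if i == k then g i j x else f i x)).
Proof.
move=> oU; elim: n f g => [|n IH] f g fg.
  by apply: grad_eq (grad_cst U 1) _ _ => [x _|j x]; rewrite big_ord0.
apply: grad_eq (gradM oU (fg ord0) (IH _ _ (fun i => fg (lift ord0 i)))) _ _ => [x _|j x].
  by rewrite big_ord_recl.
rewrite big_ord_recl big_ord_recl /=; congr (_ * _ + _).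
rewrite mulr_sumr; apply: eq_bigr => k _.
by rewrite [RHS]big_ord_recl /=.
Qed.

(** Jacobi's formula, from the Leibniz expansion: differentiating one row at a time, each
    determinant obtained is expanded along the differentiated row. *)
Lemma grad_det m (U : set 'rV[R]_m) n (M : 'rV[R]_m -> 'M[R]_n) dM :
  open U -> (forall k i, grad U (fun x => M x k i) (dM k i)) ->
  grad U (fun x => \det (M x))
    (fun j x => \sum_k \sum_i dM k i j x * cofactor (M x) k i).
Proof.
move=> oU MdM.
have gp (s : 'S_n) := grad_prod oU (fun i => MdM i (s i)).
have gd := grad_sum (index_enum _) (fun s : 'S_n => gradM oU (grad_cst U ((-1) ^+ s)) (gp s)).
apply: grad_eq gd _ _ => [x _|j x] //.
under eq_bigr do rewrite mul0r add0r mulr_sumr.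
rewrite exchange_big /=; apply: eq_bigr => k _.
pose Mk := \matrix_(i, l) (if i == k then dM i l j x else M x i l).
transitivity (\det Mk).
  apply: eq_bigr => s _; congr (_ * _); apply: eq_bigr => i _.
  by rewrite mxE.
rewrite (expand_det_row _ k); apply: eq_bigr => i _.
rewrite mxE eqxx; congr (_ * (_ * \det _)).
by apply/matrixP => u v; rewrite !mxE eq_sym (negPf (neq_lift k u)).
Qed.

Lemma Ck_det m (U : set 'rV[R]_m) n l (M : 'rV[R]_m -> 'M[R]_n) :
  open U -> (forall k i, Ck l U (fun x => M x k i)) -> Ck l U (fun x => \det (M x)).
Proof.
move=> oU MC; apply: Ck_sum => s _; apply: CkM => //; first exact: Ck_cst.
by apply: Ck_prod.
Qed.

End Grad.

(** The hypothesis says that the left kernel of M is at most a line.  For l in this kernel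
    with l_a <> 0, replace the row a of M by a vector mu orthogonal to all other rows.  If all
    cofactors of row a vanished, the new matrix would be singular; but a vector l' of its left
    kernel has l'_a = 0 because mu is orthogonal to the other rows and not to itself, so l' is
    in the kernel of M without being proportional to l. *)
Lemma cofactor_neq0 (R : realFieldType) n (M : 'M[R]_n) : \det M = 0 ->
  (forall u v : 'rV[R]_n, u *m M = 0 -> v *m M = 0 ->
     forall i j, u 0 i * v 0 j = u 0 j * v 0 i) ->
  exists a b, cofactor M a b != 0.
Proof.
move=> dM prop; apply: contrapT => N0.
have {}N0 a b : cofactor M a b = 0.
  by apply: contrapT => /eqP ab; apply: N0; exists a, b.
have /eqP/det0P [l l0 lM] := dM.
have [a la] : exists a, l 0 a != 0 by apply/rV0Pn.
have rep (mu : 'rV[R]_n) : \det (\matrix_(i, j) (if i == a then mu 0 j else M i j)) = 0.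
  rewrite (expand_det_row _ a) big1 // => j _.
  suff -> : cofactor (\matrix_(i, j) (if i == a then mu 0 j else M i j)) a j = cofactor M a j.
    by rewrite N0 mulr0.
  rewrite /cofactor; congr (_ * \det _); apply/matrixP => u v.
  by rewrite !mxE eq_sym (negPf (neq_lift a u)).
pose M0 := \matrix_(i, j) (if i == a then (0 : 'rV[R]_n) 0 j else M i j).
have /eqP : \det M0^T = 0 by rewrite det_tr rep.
move=> /det0P [mu mu0 muM0].
pose M1 := \matrix_(i, j) (if i == a then mu 0 j else M i j).
have /eqP/det0P [l' l'0 l'M] := rep mu.
have M1mu i : (M1 *m mu^T) i 0 = if i == a then \sum_j mu 0 j * mu 0 j else 0.
  rewrite mxE; under eq_bigr do rewrite [X in _ * X]mxE.
  have [ia|ia] := eqVneq i a.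
    by apply: eq_bigr => j _; rewrite mxE ia eqxx.
  have := congr1 (fun A : 'rV_n => A 0 i) muM0; rewrite !mxE => muM0i.
  transitivity (\sum_j mu 0 j * M0^T j i); last exact: muM0i.
  by apply: eq_bigr => j _; rewrite !mxE (negPf ia) mulrC.
have mumu : \sum_j mu 0 j * mu 0 j != 0.
  rewrite psumr_neq0 => [|j _]; last by rewrite -expr2 sqr_ge0.
  have [j muj] := rV0Pn _ mu0; apply/hasP; exists j; first exact: mem_index_enum.
  by rewrite -expr2 exprn_even_gt0.
have l'a : l' 0 a = 0.
  have : (l' *m M1 *m mu^T) 0 0 = 0 by rewrite l'M mul0mx mxE.
  rewrite -mulmxA mxE (bigD1 a) //= big1 ?addr0 => [|i ia].
    by rewrite M1mu eqxx => /eqP; rewrite mulf_eq0 (negPf mumu) orbF => /eqP.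
  by rewrite M1mu (negPf ia) mulr0.
have l'M0 : l' *m M = 0.
  rewrite -l'M; apply/rowP => j; rewrite !mxE; apply: eq_bigr => i _; rewrite !mxE.
  by have [->|//] := eqVneq i a; rewrite l'a !mul0r.
case/negP: l'0; apply/eqP/rowP => k; rewrite mxE; apply/eqP.
have := prop _ _ lM l'M0 a k; rewrite l'a mulr0 => /eqP.
by rewrite mulf_eq0 (negPf la).
Qed.

(** * Nondegeneracy of the determinant of arguments *)

Section RealFrame.
Variable R : realType.
Local Notation C := R[i].
Implicit Types (D : 'M[C]_(2, 4)) (a z v : 'rV[C]_4) (u : 'rV[R]_4).
Local Notation real8 := (@real8_of_complex R).

Lemma rV_split_eq (V : Type) m n (x y : 'rV[V]_(m + n)) :
  (forall j, x 0 (lshift n j) = y 0 (lshift n j)) ->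
  (forall j, x 0 (rshift m j) = y 0 (rshift m j)) -> x = y.
Proof. by move=> el er; apply/rowP => l; case: (split_ordP l) => j ->. Qed.

Lemma real8_l z j : real8 z 0 (lshift 4 j) = Re (z 0 j).
Proof. by rewrite /real8_of_complex row_mxEl mxE. Qed.

Lemma real8_r z j : real8 z 0 (rshift 4 j) = Im (z 0 j).
Proof. by rewrite /real8_of_complex row_mxEr mxE. Qed.

Lemma real8_inj : injective real8.
Proof.
move=> z z' e; apply/rowP => j; apply/eqP; rewrite eq_complex.
by rewrite -!real8_l -!real8_r e !eqxx.
Qed.

Lemma real8B z z' : real8 (z - z') = real8 z - real8 z'.
Proof.
apply: rV_split_eq => j; rewrite [RHS]mxE [X in _ = _ + X]mxE.
  by rewrite !real8_l !mxE; case: (z 0 j) (z' 0 j) => ? ? [].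
by rewrite !real8_r !mxE; case: (z 0 j) (z' 0 j) => ? ? [].
Qed.

Definition frame_coef u (e : 'I_2) : C :=
  if e == 0 then u 0 o0 +i* u 0 o1 else u 0 o2 +i* u 0 o3.

Definition frame_vec D u : 'rV[C]_4 :=
  \row_j (frame_coef u 0 * D 0 j + frame_coef u 1 * D 1 j).

Lemma frame_vecE D u j :
  frame_vec D u 0 j = frame_coef u 0 * D 0 j + frame_coef u 1 * D 1 j.
Proof. by rewrite mxE. Qed.

(** The real basis d_0, i d_0, d_1, i d_1 of the complex row space of D, in real
    coordinates. *)
Definition real_frame D : 'M[R]_(4, 4 + 4) :=
  \matrix_k real8 (frame_vec D (delta_mx 0 k)).

Lemma real_frameE D u : u *m real_frame D = real8 (frame_vec D u).
Proof.
apply: rV_split_eq => j; rewrite mxE sum4.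
  rewrite ![real_frame D _ _]mxE !real8_l !mxE /frame_coef !mxE !eqxx /=.
  by case: (D 0 j) (D 1 j) => ? ? [? ?] /=; ring.
rewrite ![real_frame D _ _]mxE !real8_r !mxE /frame_coef !mxE !eqxx /=.
by case: (D 0 j) (D 1 j) => ? ? [? ?] /=; ring.
Qed.

Lemma sub_frameP D v : (v <= D)%MS <-> exists u, v = frame_vec D u.
Proof.
have sE (s : 'rV[C]_2) j : (s *m D) 0 j = s 0 0 * D 0 j + s 0 1 * D 1 j.
  by rewrite mxE !big_ord_recl big_ord0 addr0; congr (_ + s 0 _ * D _ j); exact: val_inj.
split=> [/submxP[s vE]|[u ->]].
  exists (\row_k nth 0 [:: Re (s 0 0); Im (s 0 0); Re (s 0 1); Im (s 0 1)] k).
  apply/rowP => j; rewrite vE sE frame_vecE /frame_coef !mxE /=.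
  by case: (s 0 0) (s 0 1) => ? ? [].
apply/submxP; exists (\row_e frame_coef u e).
by apply/rowP => j; rewrite sE !mxE.
Qed.

Lemma sub_real_frame D v : (v <= D)%MS <-> (real8 v <= real_frame D)%MS.
Proof.
rewrite sub_frameP; split=> [[u ->]|/submxP[u]].
  by rewrite -real_frameE submxMl.
by rewrite real_frameE => /real8_inj ->; exists u.
Qed.

Lemma real_frame_free D : row_free D -> row_free (real_frame D).
Proof.
move=> Df; apply: inj_row_free => u; rewrite real_frameE => u0.
have v0 : frame_vec D u = 0.
  apply: real8_inj; rewrite u0; apply: rV_split_eq => j.
    by rewrite real8_l !mxE.
  by rewrite real8_r !mxE.
pose s : 'rV[C]_2 := \row_e frame_coef u e.
have sD : s *m D = 0 *m D.
  rewrite mul0mx -v0; apply/rowP => j.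
  rewrite mxE !big_ord_recl big_ord0 addr0 !mxE /=; congr (_ + _ * D _ j); exact: val_inj.
have s0 := row_free_inj Df sD.
have /rowP/(_ 0) := s0; have /rowP/(_ 1) := s0.
rewrite !mxE /frame_coef /= => -[e2 e3] [e0 e1].
by apply/rowP; apply: forall4; rewrite mxE.
Qed.

(** Up to a nonzero factor, the differential at x of the argument of the j-th complex
    coordinate, applied to w. *)
Definition wedge (x w : 'rV[R]_(4 + 4)) (j : 'I_4) : R :=
  x 0 (lshift 4 j) * w 0 (rshift 4 j) - x 0 (rshift 4 j) * w 0 (lshift 4 j).

Lemma wedge_real8 z v j : wedge (real8 z) (real8 v) j = Im (conjc (z 0 j) * v 0 j).
Proof.
rewrite /wedge !real8_l !real8_r; case: (z 0 j) (v 0 j) => ? ? [? ?] /=; ring.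
Qed.

(** The differential of the arguments on the direction of the plane, up to a nonzero factor
    in each column. *)
Definition arg_mx D (x : 'rV[R]_(4 + 4)) : 'M[R]_4 :=
  \matrix_(k, j) wedge x (row k (real_frame D)) j.

Lemma mul_arg_mx D x u j : (u *m arg_mx D x) 0 j = wedge x (u *m real_frame D) j.
Proof.
rewrite /arg_mx; move: (real_frame D) => T.
rewrite /wedge !mxE !mulr_sumr -sumrB; apply: eq_bigr => k _.
rewrite !mxE; ring.
Qed.

(** The base point of a plane can be replaced by any other of its points. *)
Lemma minor3_translate a z D i j k : (z - a <= D)%MS -> minor3 z D i j k = minor3 a D i j k.
Proof.
move=> /sub_frameP[u zu]; have zE : z = a + frame_vec D u by rewrite -zu addrC subrK.
rewrite zE /minor3 /minor2 !mxE; ring.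
Qed.

(** Let N : C^4 -> C^2 have the row space of D as kernel.  By duality the minors of D and of
    (a, D) are the 2 x 2 minors of N e_0, N e_1, N e_2, N e_3 and N a, up to signs and a common
    factor.  So this is, up to a positive factor, the imaginary part of a cross-ratio of
    N e_0, N a, N e_1, N e_2 as points of the projective line. *)
Definition im_cross_base a D : R :=
  Im (minor2 D o2 o3 * minor3 a D o0 o1 o3 * conjc (minor2 D o1 o3 * minor3 a D o0 o2 o3)).

(** Likewise for a cross-ratio of N e_0, N e_1, N e_2, N e_3. *)
Definition im_cross_directions D : R :=
  Im (minor2 D o0 o1 * minor2 D o2 o3 * conjc (minor2 D o0 o2 * minor2 D o1 o3)).

(** A vector v is in this kernel when all Im (conj z_j v_j) vanish, that is when all v_j / z_j
    are real. *)
Lemma kernel_real_multiple D z (l : 'rV[R]_4) : (forall j, z 0 j != 0) ->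
  l *m arg_mx D (real8 z) = 0 ->
  exists r : 'I_4 -> R, forall j, (r j)%:C * z 0 j = frame_vec D l 0 j.
Proof.
move=> z0 lM.
exists (fun j => Re (frame_vec D l 0 j / z 0 j)) => j.
have /rowP/(_ j) := lM; rewrite mul_arg_mx real_frameE wedge_real8 [RHS]mxE.
set v := frame_vec D l 0 j => Im0.
have zj := z0 j.
have rE : v / z 0 j = (Re (v / z 0 j))%:C.
  have : Im (v / z 0 j) = 0.
    have -> : v / z 0 j = ((z 0 j * conjc (z 0 j))^-1) * (conjc (z 0 j) * v).
      by field; rewrite conjc_eq0 zj.
    rewrite (_ : z 0 j * conjc (z 0 j) = (Re (z 0 j) ^+ 2 + Im (z 0 j) ^+ 2)%:C); last first.
      by case: (z 0 j) => c d; simpc; congr (_ +i* _); ring.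
    rewrite -fmorphV /=; case: (conjc (z 0 j) * v) Im0 => c d /= ->.
    by rewrite mulr0 mul0r addr0.
  by case: (v / z 0 j) => c d /= ->.
by rewrite -rE mulfVK.
Qed.

(** Two independent elements of the left kernel would give two independent real multiples
    of z in the direction of the plane, which real_span_cross_ratio excludes. *)
Lemma kernel_proportional a D z : row_free D -> (forall j, z 0 j != 0) -> (z - a <= D)%MS ->
  im_cross_base a D != 0 -> forall l l' : 'rV[R]_4,
  l *m arg_mx D (real8 z) = 0 -> l' *m arg_mx D (real8 z) = 0 ->
  forall i j, l 0 i * l' 0 j = l 0 j * l' 0 i.
Proof.
move=> Df z0 za g1 l l' lM lM' i j.
have [r rz] := kernel_real_multiple z0 lM; have [r' rz'] := kernel_real_multiple z0 lM'.
have rr k b : r k * r' b = r b * r' k.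
  apply/eqP; apply: contraNT g1 => rkb; apply/eqP.
  rewrite /im_cross_base -!(minor3_translate _ _ _ za).
  apply: (real_span_cross_ratio z0 _ _ rkb) => m; last exact: (etrans (rz' m) (frame_vecE _ _ _)).
  exact: (etrans (rz m) (frame_vecE _ _ _)).
have uT (u : 'rV[R]_4) rho : (forall j, (rho j)%:C * z 0 j = frame_vec D u 0 j) ->
    forall j, (u *m real_frame D) 0 (lshift 4 j) = rho j * Re (z 0 j) /\
      (u *m real_frame D) 0 (rshift 4 j) = rho j * Im (z 0 j).
  move=> rhoz m; rewrite real_frameE real8_l real8_r -rhoz.
  by case: (z 0 m) => x y /=; rewrite !mul0r subr0 addr0.
have inj (u : 'rV[R]_4) : u *m real_frame D = 0 -> u = 0.
  by move=> u0; apply: (row_free_inj (real_frame_free Df)); rewrite u0 mul0mx.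
have [r0|/existsNP[k /eqP rk]] := pselect (forall k, r k = 0).
  have -> : l = 0.
    apply: inj; apply: rV_split_eq => m; rewrite [RHS]mxE.
      by rewrite (uT _ _ rz m).1 r0 mul0r.
    by rewrite (uT _ _ rz m).2 r0 mul0r.
  by rewrite !mxE !mul0r.
have ll : r k *: l' - r' k *: l = 0.
  apply: inj; rewrite mulmxBl -!scalemxAl.
  move: (uT _ _ rz) (uT _ _ rz'); move: (l *m _) (l' *m _) => A B AE BE.
  apply: rV_split_eq => m; rewrite !mxE.
    by rewrite (AE m).1 (BE m).1 !mulrA rr (mulrC (r m)) subrr.
  by rewrite (AE m).2 (BE m).2 !mulrA rr (mulrC (r m)) subrr.
have lE m : r k * l' 0 m = r' k * l 0 m.
  by have /rowP/(_ m) := ll; rewrite !mxE => /eqP; rewrite subr_eq0 => /eqP.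
by apply: (mulfI rk); rewrite mulrCA lE mulrCA [RHS]mulrCA lE; ring.
Qed.

Definition arg_mx_grad D (k j : 'I_4) (l : 'I_(4 + 4)) : R :=
  (l == lshift 4 j)%:R * real_frame D k (rshift 4 j) -
  (l == rshift 4 j)%:R * real_frame D k (lshift 4 j).

Definition arg_det_grad D (l : 'I_(4 + 4)) (x : 'rV[R]_(4 + 4)) : R :=
  \sum_k \sum_j arg_mx_grad D k j l * cofactor (arg_mx D x) k j.

Lemma arg_mx_smooth D l (U : set 'rV[R]_(4 + 4)) k j : open U -> Ck l U (fun x => arg_mx D x k j).
Proof.
move=> oU.
apply: (@Ck_eq _ _ _ _ (fun x => x 0 (lshift 4 j) * real_frame D k (rshift 4 j) +
   x 0 (rshift 4 j) * (- real_frame D k (lshift 4 j)))).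
  by move=> x _; rewrite [RHS]mxE /wedge ![row _ _ _ _]mxE mulrN.
by apply: CkD; apply: CkM => //; first [exact: Ck_coord|exact: Ck_cst].
Qed.

Lemma arg_mx_gradP D (U : set 'rV[R]_(4 + 4)) k j : open U ->
  grad U (fun x => arg_mx D x k j) (fun l _ => arg_mx_grad D k j l).
Proof.
move=> oU.
have gc i c := gradM oU (grad_coord U i) (grad_cst U c).
apply: grad_eq (gradD (gc (lshift 4 j) (real_frame D k (rshift 4 j)))
  (gc (rshift 4 j) (- real_frame D k (lshift 4 j)))) _ _ => [x _|l x] /=.
  by rewrite [RHS]mxE /wedge ![row _ _ _ _]mxE mulrN.
by rewrite /arg_mx_grad !mulr0 !addr0 mulrN.
Qed.

Lemma arg_det_gradP D (U : set 'rV[R]_(4 + 4)) : open U ->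
  grad U (fun x => \det (arg_mx D x)) (arg_det_grad D).
Proof. by move=> oU; apply: grad_det => // k j; exact: arg_mx_gradP. Qed.

Lemma arg_det_smooth D l (U : set 'rV[R]_(4 + 4)) : open U -> Ck l U (fun x => \det (arg_mx D x)).
Proof. by move=> oU; apply: Ck_det => // k j; exact: arg_mx_smooth. Qed.

Lemma arg_det_grad_dir D x (w : 'rV[R]_(4 + 4)) : \sum_l w 0 l * arg_det_grad D l x =
  \sum_k \sum_j wedge w (row k (real_frame D)) j * cofactor (arg_mx D x) k j.
Proof.
rewrite /arg_det_grad; under eq_bigr do rewrite mulr_sumr.
rewrite exchange_big /=; apply: eq_bigr => k _.
under eq_bigr do rewrite mulr_sumr.
rewrite exchange_big /=; apply: eq_bigr => j _.
under eq_bigr do rewrite mulrA.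
rewrite -mulr_suml; congr (_ * _).
rewrite /arg_mx_grad /wedge ![row _ _ _ _]mxE.
under eq_bigr do rewrite mulrBr !mulrA.
rewrite sumrB -!mulr_suml; congr (_ * _ - _ * _).
  by rewrite (bigD1 (lshift 4 j)) //= eqxx mulr1 big1 ?addr0 // => l /negPf ->; rewrite mulr0.
by rewrite (bigD1 (rshift 4 j)) //= eqxx mulr1 big1 ?addr0 // => l /negPf ->; rewrite mulr0.
Qed.

Let ImD (x y : C) : Im (x + y) = Im x + Im y. Proof. by case: x y => ? ? []. Qed.
Let ImZ (c : R) (x : C) : Im (c%:C * x) = c * Im x.
Proof. by case: x => ? ? /=; rewrite mul0r addr0. Qed.
Let Im_sum (f : 'I_4 -> C) : Im (\sum_j f j) = \sum_j Im (f j).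
Proof. by rewrite !sum4 !ImD. Qed.

(** A complex form whose imaginary part vanishes on a complex subspace vanishes there,
    as one sees by multiplying vectors by i. *)
Lemma complex_form_eq0 D z (mu : 'I_4 -> R) :
  (forall u, \sum_j mu j * Im (conjc (z 0 j) * frame_vec D u 0 j) = 0) ->
  forall e, \sum_j (mu j)%:C * conjc (z 0 j) * D e j = 0.
Proof.
move=> mu0 e; set S := \sum_j _.
have Sv (c : C) u : (forall j, frame_vec D u 0 j = c * D e j) -> Im (c * S) = 0.
  move=> uD; rewrite -(mu0 u) /S mulr_sumr Im_sum; apply: eq_bigr => j _.
  by rewrite uD -ImZ; congr (Im _); ring.
have frE k j (c0 c1 : C) : frame_coef (delta_mx 0 k) 0 = c0 -> frame_coef (delta_mx 0 k) 1 = c1 ->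
    frame_vec D (delta_mx 0 k) 0 j = c0 * D 0 j + c1 * D 1 j.
  by move=> <- <-; rewrite frame_vecE.
have [k [k' [kE k'E]]] : exists k k', (forall j, frame_vec D (delta_mx 0 k) 0 j = 1 * D e j) /\
    (forall j, frame_vec D (delta_mx 0 k') 0 j = 'i * D e j).
  have e01 : e = 0 \/ e = 1.
    by case: (e) => -[|[|//]] ?; [left|right]; exact: val_inj.
  case: e01 => ->; [exists o0, o1|exists o2, o3]; split=> j.
  - by rewrite (frE _ _ 1 0) ?mul0r ?addr0 // /frame_coef !mxE.
  - by rewrite (frE _ _ 'i 0) ?mul0r ?addr0 // /frame_coef !mxE.
  - by rewrite (frE _ _ 0 1) ?mul0r ?add0r // /frame_coef !mxE.
  - by rewrite (frE _ _ 0 'i) ?mul0r ?add0r // /frame_coef !mxE.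
have S1 := Sv _ _ kE; have Si := Sv _ _ k'E; rewrite mul1r in S1.
by move: S1 Si; case: (S) => x y /= -> ; rewrite mul0r mul1r add0r => ->.
Qed.

(** The left kernel of M = arg_mx D z is a line, so the cofactor matrix is a nonzero matrix
    l * lam of rank one, with l in the left and lam in the right kernel.  With w the vector of
    the direction of the plane that corresponds to l, one has w_j = r_j z_j with r_j real, and
    by Jacobi's formula the derivative of det along v is, up to a factor, the sum of the
    lam_j Im (conj v_j w_j).  If this vanished for all v, then, together with M lam = 0,
    both lam_j conj z_j and r_j lam_j conj z_j would be the coefficients of forms vanishing on
    the direction of the plane, against real_annihilators. *)
Lemma arg_det_regular a D z : row_free D -> (forall j, z 0 j != 0) -> (z - a <= D)%MS ->
  im_cross_base a D != 0 -> im_cross_directions D != 0 ->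
  minor3 a D o0 o1 o2 != 0 -> minor3 a D o1 o2 o3 != 0 ->
  \det (arg_mx D (real8 z)) = 0 ->
  exists k, \sum_l real_frame D k l * arg_det_grad D l (real8 z) != 0.
Proof.
move=> Df z0 za g1 g2 q3 q0 dM; apply: contrapT => dir0.
have prop := kernel_proportional Df z0 za g1.
have [b [c Nbc]] := cofactor_neq0 dM prop.
set M := arg_mx D (real8 z) in dM prop Nbc *.
pose l : 'rV[R]_4 := \row_k cofactor M k c.
have lM j : (\row_k cofactor M k j) *m M = 0.
  have := mul_adj_mx M; rewrite dM => adjM.
  have -> : \row_k cofactor M k j = row j (\adj M) by apply/rowP => k; rewrite !mxE.
  by rewrite -row_mul adjM; apply/rowP => i; rewrite !mxE mul0rn.
have Mlam k : \sum_j M k j * cofactor M b j = 0.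
  have /matrixP/(_ k b) := mul_mx_adj M; rewrite dM !mxE mul0rn => adjM.
  by rewrite -[RHS]adjM; apply: eq_bigr => j _; rewrite [X in _ = _ * X]mxE.
(* the columns of the cofactor matrix lie in the left kernel, which is a line *)
have rank1 k j : cofactor M k j * cofactor M b c = cofactor M k c * cofactor M b j.
  by have := prop _ _ (lM j) (lM c) k b; rewrite !mxE => ->; rewrite mulrC.
have [r rz] := kernel_real_multiple z0 (lM c); rewrite -/l in rz.
pose lam j := cofactor M b j.
have H2 (u : 'rV[R]_4) : \sum_j lam j * Im (conjc (z 0 j) * frame_vec D u 0 j) = 0.
  transitivity (\sum_j (u *m M) 0 j * lam j).
    by apply: eq_bigr => j _; rewrite mul_arg_mx real_frameE wedge_real8 mulrC.
  under eq_bigr do rewrite mxE mulr_suml.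
  rewrite exchange_big big1 //= => k _.
  by under eq_bigr do rewrite -mulrA; rewrite -mulr_sumr Mlam mulr0.
have H1 (u : 'rV[R]_4) : \sum_j (r j * lam j) * Im (conjc (z 0 j) * frame_vec D u 0 j) = 0.
  have : \sum_l (u *m real_frame D) 0 l * arg_det_grad D l (real8 z) = 0.
    under eq_bigr do rewrite mxE mulr_suml.
    rewrite exchange_big big1 //= => k _.
    under eq_bigr do rewrite -mulrA; rewrite -mulr_sumr.
    suff -> : \sum_i real_frame D k i * arg_det_grad D i (real8 z) = 0 by rewrite mulr0.
    by apply: contrapT => /eqP dk; apply: dir0; exists k.
  rewrite arg_det_grad_dir -/M exchange_big /= => dir.
  apply/eqP; rewrite -oppr_eq0 -sumrN; apply/eqP.
  have dirN := congr1 (fun t => t * cofactor M b c) dir.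
  rewrite /= mul0r mulr_suml in dirN; rewrite -[RHS]dirN; apply: eq_bigr => j _.
  rewrite mulr_suml; under [RHS]eq_bigr do rewrite -mulrA rank1 mulrA mulrC.
  rewrite -mulr_sumr -/(lam j).
  have -> : \sum_i wedge (u *m real_frame D) (row i (real_frame D)) j * cofactor M i c =
      wedge (u *m real_frame D) (l *m real_frame D) j.
    by rewrite -mul_arg_mx mxE; apply: eq_bigr => i _; rewrite !mxE mulrC.
  rewrite !real_frameE wedge_real8 -rz.
  by case: (z 0 j) (frame_vec D u 0 j) => x y [x' y'] /=; ring.
have qE i j k : minor3 z D i j k = minor3 a D i j k by exact: minor3_translate.
have [q1 q2] : minor3 a D o0 o1 o3 != 0 /\ minor3 a D o0 o2 o3 != 0.
  split; apply: contraNneq g1; rewrite /im_cross_base => ->; first by rewrite mulr0 mul0r.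
  by rewrite mulr0 rmorph0 mulr0.
rewrite -!qE in q0 q1 q2 q3.
have rzD j := etrans (rz j) (frame_vecE D l j).
have lamD := complex_form_eq0 H2; have rlamD := complex_form_eq0 H1.
case: (real_annihilators z0 rzD lamD rlamD g2 q3 q1 q2 q0) => [r0|lam0].
  have : l = 0.
    apply: (row_free_inj (real_frame_free Df)); rewrite mul0mx real_frameE.
    apply: rV_split_eq => j; rewrite ?real8_l ?real8_r -rz r0 mul0r [RHS]mxE //.
  by move=> /rowP/(_ b); rewrite !mxE => /eqP; rewrite (negPf Nbc).
by have := lam0 c; rewrite /lam => /eqP; rewrite (negPf Nbc).
Qed.

End RealFrame.

(** * Charts of the projective line and critical points *)

Section Charts.
Variable R : realType.
Local Notation C := R[i].
Implicit Types (D : 'M[C]_(2, 4)) (a z v : 'rV[C]_4) (u : 'rV[R]_4).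
Local Notation real8 := (@real8_of_complex R).

Definition chart_den (e : bool) (x y : R) := if e then x else y.
Definition chart_num (e : bool) (x y : R) := if e then y else x.

Lemma homog_eqP (x y x' y' : R) : x * y' = y * x' -> (x, y) != (0, 0) -> (x', y') != (0, 0) ->
  homog x y = homog x' y'.
Proof.
move=> xy n n'.
have sub (a b a' b' : R) : a * b' = b * a' -> (a', b') != (0, 0) -> (homog a b <= homog a' b')%VS.
  move=> ab nab; rewrite -memvE; apply/vlineP.
  have sE (k : R) : a = k * a' -> b = k * b' ->
      (a : R^o, b : R^o) = k *: (a' : R^o, b' : R^o) by move=> -> ->.
  have [a0|a0] := eqVneq a' 0.
    have b0 : b' != 0 by apply: contraNneq nab => ->; rewrite a0.
    exists (b / b'); apply: sE; last by rewrite mulfVK.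
    move: ab; rewrite a0 !mulr0 => /eqP; rewrite mulf_eq0 (negPf b0) orbF => /eqP //.
  exists (a / a'); apply: sE; first by rewrite mulfVK.
  by apply: (mulIf a0); rewrite -ab [RHS]mulrAC mulfVK.
by apply/eqP; rewrite eqEsubv !sub // mulrC -xy mulrC.
Qed.

Lemma RP1_chart_invP e (x y r : R) :
  RP1_chart_inv e r = homog x y <-> chart_den e x y != 0 /\ r = chart_num e x y / chart_den e x y.
Proof.
have mem (c d : R) : homog c d = homog x y -> exists k : R, c = k * x /\ d = k * y.
  move=> E; have : (c : R^o, d : R^o) \in homog x y by rewrite -E memv_line.
  by move=> /vlineP[k [-> ->]]; exists k.
case: e => /=; split.
- move=> /mem[k [k1 ->]]; have x0 : x != 0.
    by apply/eqP => x0; move/eqP: k1; rewrite x0 mulr0 oner_eq0.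
  by split=> //; apply: (mulIf x0); rewrite mulfVK // mulrAC -k1 mul1r.
- move=> [x0 ->]; apply: homog_eqP.
  + by rewrite mul1r mulfVK.
  + by rewrite xpair_eqE oner_eq0.
  + by rewrite xpair_eqE (negPf x0).
- move=> /mem[k [-> k1]]; have x0 : y != 0.
    by apply/eqP => x0; move/eqP: k1; rewrite x0 mulr0 oner_eq0.
  by split=> //; apply: (mulIf x0); rewrite mulfVK // mulrAC -k1 mul1r.
- move=> [x0 ->]; apply: homog_eqP.
  + by rewrite mulfVK // mul1r.
  + by rewrite xpair_eqE oner_eq0 andbF.
  + by rewrite xpair_eqE (negPf x0) andbF.
Qed.

Lemma RP1_chartE e (x y : R) : chart_den e x y != 0 ->
  RP1_chart e (homog x y) = chart_num e x y / chart_den e x y.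
Proof.
move=> d0; rewrite /RP1_chart; case: xgetP => [r _ /RP1_chart_invP[_ ->] //|].
by move=> /(_ (chart_num e x y / chart_den e x y)) []; apply/RP1_chart_invP.
Qed.

Lemma RP1_chart_domP e (x y : R) : RP1_chart_dom e (homog x y) <-> chart_den e x y != 0.
Proof.
split=> [[r _ /RP1_chart_invP[]//]|d0].
by exists (chart_num e x y / chart_den e x y) => //; apply/RP1_chart_invP.
Qed.

Lemma open_neq0 m (f : 'rV[R]_m -> R) : Ck 1 setT f -> open [set x | f x != 0].
Proof.
move=> [h Sh _]; rewrite (_ : [set x | f x != 0] = f @^-1` [set r | r != 0]) //.
apply: open_comp; last exact: open_neq.
by move=> x _; exact: (slopes_continuous openT Sh).
Qed.

Section Chart.
Variable e : 'I_4 -> bool.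
Let den j (x : 'rV[R]_(4 + 4)) := chart_den (e j) (x 0 (lshift 4 j)) (x 0 (rshift 4 j)).
Let num j (x : 'rV[R]_(4 + 4)) := chart_num (e j) (x 0 (lshift 4 j)) (x 0 (rshift 4 j)).
Let U := [set x : 'rV[R]_(4 + 4) | \prod_j den j x != 0].

Let idx (b : bool) j : 'I_(4 + 4) := if b then lshift 4 j else rshift 4 j.
Let denE j x : den j x = x 0 (idx (e j) j). Proof. by rewrite /den /idx; case: (e j). Qed.
Let numE j x : num j x = x 0 (idx (~~ e j) j). Proof. by rewrite /num /idx; case: (e j). Qed.

Let oU : open U.
Proof.
apply: open_neq0; apply: Ck_prod; first exact: openT.
by move=> j; apply: Ck_eq (Ck_coord _ _ (idx (e j) j)) => x _; rewrite denE.
Qed.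

Let UP x : U x <-> forall j, den j x != 0.
Proof.
split=> [/prodf_neq0 d j|d]; first exact: d.
by apply/prodf_neq0 => j _.
Qed.

Lemma twoArg_in_chart_diff x : (forall j, den j x != 0) -> forall w,
  'd (twoArg_in_chart e) x w =
  \row_j ((if e j then 1 else -1) / (den j x * den j x) * wedge x w j).
Proof.
move=> /UP Ux w.
have gj j := gradM oU (grad_coord U (idx (~~ e j) j))
  (gradV oU (fun y (Uy : U y) => (eq_ind _ (fun t => t != 0) ((UP y).1 Uy j) _ (denE j y)))
   (grad_coord U (idx (e j) j))).
have gF j := grad_eq (f' := fun y => twoArg_in_chart e y 0 j) (gj j) _ (fun _ _ => erefl).
have FE j y : U y -> y 0 (idx (~~ e j) j) / y 0 (idx (e j) j) = twoArg_in_chart e y 0 j.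
  move=> Uy; rewrite /twoArg_in_chart mxE /twoArg /complex_of_real8 !mxE /= RP1_chartE.
    by rewrite -/(den j y) -/(num j y) numE denE.
  by rewrite -/(den j y); exact: (UP y).1.
have /choice[h hP] : forall j, exists h, slopes U (fun y => twoArg_in_chart e y 0 j) h /\
   forall l y, h l (y, y) = (l == idx (~~ e j) j)%:R * (y 0 (idx (e j) j))^-1 +
      y 0 (idx (~~ e j) j) * (- (l == idx (e j) j)%:R / (y 0 (idx (e j) j) * y 0 (idx (e j) j))).
  by move=> j; have [h Sh hE] := gF FE j; exists h.
have [_ ->] := slopes_diff oU Ux (fun j => (hP j).1).
apply/rowP => j; rewrite !mxE.
under eq_bigr do rewrite (hP j).2 mulrDr.
have delta i : \sum_l w 0 l * (l == i)%:R = w 0 i.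
  by rewrite (bigD1 i) //= eqxx mulr1 big1 ?addr0 // => l /negPf ->; rewrite mulr0.
rewrite big_split /=.
have -> : \sum_i w 0 i * ((i == idx (~~ e j) j)%:R / x 0 (idx (e j) j)) =
   w 0 (idx (~~ e j) j) / x 0 (idx (e j) j).
  by under eq_bigr do rewrite mulrA; rewrite -mulr_suml delta.
set den2 := x 0 _ * x 0 _.
have -> : \sum_i w 0 i * (x 0 (idx (~~ e j) j) * (- (i == idx (e j) j)%:R / den2)) =
   - (w 0 (idx (e j) j) * x 0 (idx (~~ e j) j) / den2).
  rewrite -delta !mulr_suml -sumrN; apply: eq_bigr => l _; ring.
have := (UP x).1 Ux j; rewrite !denE /den2 /wedge /idx.
by case: (e j) => /= d0; field.
Qed.

End Chart.

Lemma direction_planeP a D v : direction (affine_plane_of a D) v <-> (v <= D)%MS.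
Proof.
split=> [[x [y [Vx Vy ->]]]|vD].
  have -> : x - y = (x - a) - (y - a) by rewrite opprB addrA subrK.
  by apply: addmx_sub => //; rewrite eqmx_opp.
by exists (a + v), a; split; rewrite /affine_plane_of /= ?(addrC a v) ?addrK ?subrr ?sub0mx.
Qed.

(** In a chart the differential is arg_mx up to nonzero factors on the columns, and a square
    matrix is surjective exactly when its determinant is nonzero. *)
Lemma criticalP a D z : row_free D -> rolled_coamoeba_critical (affine_plane_of a D) z <->
  [/\ (z - a <= D)%MS, forall j, z 0 j != 0 & \det (arg_mx D (real8 z)) = 0].
Proof.
move=> Df.
have den_j e j : chart_den (e j) (real8 z 0 (lshift 4 j)) (real8 z 0 (rshift 4 j)) =
    chart_den (e j) (Re (z 0 j)) (Im (z 0 j)) by rewrite real8_l real8_r.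
have surj (e : 'I_4 -> bool) : (forall j, RP1_chart_dom (e j) (twoArg z j)) ->
  (forall w : 'rV[R]_4, exists2 v, direction (affine_plane_of a D) v &
           'd (twoArg_in_chart e) (real8 z) (real8 v) = w) <->
  \det (arg_mx D (real8 z)) != 0.
  move=> dom.
  pose den j := chart_den (e j) (real8 z 0 (lshift 4 j)) (real8 z 0 (rshift 4 j)).
  have d0 j : den j != 0 by rewrite /den den_j; apply/RP1_chart_domP; exact: dom.
  pose c j := (if e j then 1 else -1) / (den j * den j).
  have c0 j : c j != 0.
    by rewrite mulf_neq0 ?invr_neq0 ?mulf_neq0 //; case: (e j); rewrite ?oppr_eq0 oner_eq0.
  have dE u j : 'd (twoArg_in_chart e) (real8 z) (real8 (frame_vec D u)) 0 j =
      c j * (u *m arg_mx D (real8 z)) 0 j.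
    by rewrite twoArg_in_chart_diff // mxE mul_arg_mx real_frameE.
  split=> [surj|dM].
    apply/negP => /eqP; rewrite -det_tr => /eqP/det0P[mu mu0 muM].
    have [v /direction_planeP/sub_frameP[u ->] du] := surj (\row_j (c j * mu 0 j)).
    have uM j : (u *m arg_mx D (real8 z)) 0 j = mu 0 j.
      by apply: (mulfI (c0 j)); rewrite -dE du mxE.
    have : \sum_j mu 0 j * mu 0 j = 0.
      transitivity ((mu *m (arg_mx D (real8 z))^T *m u^T) 0 0); last by rewrite muM mul0mx mxE.
      rewrite -mulmxA -trmx_mul mxE; apply: eq_bigr => j _; rewrite [X in _ = _ * X]mxE.
      by rewrite uM.
    move/eqP; rewrite psumr_eq0 => [/allP mm|j _]; last by rewrite -expr2 sqr_ge0.
    case/negP: mu0; apply/eqP/rowP => j; rewrite mxE; apply/eqP.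
    by have := mm j (mem_index_enum _); rewrite /= mulf_eq0 orbb.
  move=> w; pose u := (\row_j (w 0 j / c j)) *m invmx (arg_mx D (real8 z)).
  exists (frame_vec D u); first by apply/direction_planeP/sub_frameP; exists u.
  apply/rowP => j; rewrite dE mulmxKV ?unitmxE ?unitfE // mxE mulrC mulfVK //.
split.
  move=> [[Vz z0] [e [dom ns]]]; split=> //.
  by apply: contrapT => /eqP dM; apply: ns; apply/surj.
move=> [Vz z0 dM]; split=> //.
(* the first chart, unless the point is at infinity in it *)
pose e j := Re (z 0 j) != 0.
have dom j : RP1_chart_dom (e j) (twoArg z j).
  apply/RP1_chart_domP; rewrite /chart_den /e; case: ifP => // /eqP re0.
  by apply: contra (z0 j) => /eqP im0; rewrite eq_complex re0 im0 !eqxx.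
by exists e; split=> // /(surj _ dom); rewrite dM eqxx.
Qed.

End Charts.

(** * The critical set of a generic plane *)

Section Completion.
Variables (F : fieldType) (m n : nat) (T : 'M[F]_(m, n)).
Hypothesis Tf : row_free T.

Lemma sub_pid_mxP (y : 'rV[F]_n) :
  (y <= (pid_mx m : 'M[F]_(m, n)))%MS <-> forall j : 'I_n, (m <= j)%N -> y 0 j = 0.
Proof.
split=> [/submxP[s ->] j mj|y0].
  rewrite mxE big1 // => i _; rewrite mxE (_ : _ == _ = false) ?mulr0 //.
  by apply/negbTE; rewrite neq_ltn (leq_trans (ltn_ord i) mj).
have -> : y = y *m (pid_mx m : 'M[F]_(n, m)) *m (pid_mx m : 'M[F]_(m, n)).
  rewrite -mulmxA mul_pid_mx !minnn; apply/rowP => j.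
  rewrite mxE (bigD1 j) //= big1 ?addr0 => [|i ij].
    rewrite mxE eqxx /=; have [jm|mj] := ltnP j m; first by rewrite mulr1.
    by rewrite mulr0 y0.
  by rewrite mxE (_ : _ == _ = false) ?mulr0 //; apply/negbTE.
exact: submxMl.
Qed.

Lemma eqmx_row_ebase : (T :=: (pid_mx m : 'M[F]_(m, n)) *m row_ebase T)%MS.
Proof.
have {1}-> : T = col_ebase T *m ((pid_mx m : 'M[F]_(m, n)) *m row_ebase T).
  by have := mulmx_ebase T; rewrite (eqP Tf) mulmxA => ->.
by apply: eqmxMfull; rewrite row_full_unit col_ebase_unit.
Qed.

(** Completing a free family T to a basis: the row space of T is cut out by the vanishing of
    the last coordinates in the basis row_ebase T. *)
Lemma sub_row_ebaseP (x : 'rV[F]_n) :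
  (x <= T)%MS <-> forall j : 'I_n, (m <= j)%N -> (x *m invmx (row_ebase T)) 0 j = 0.
Proof.
have Eu := row_ebase_unit T.
rewrite -sub_pid_mxP eqmx_row_ebase.
by rewrite -{1}(mulmxKV Eu x) submxMfree // row_free_unit.
Qed.

Lemma mul_row_perm (s : 'S_n) (y : 'rV[F]_n) (E : 'M[F]_n) :
  col_perm s y *m row_perm s E = y *m E.
Proof.
apply/rowP => j; rewrite !mxE [RHS](reindex_inj (@perm_inj _ s)) /=.
by apply: eq_bigr => i _; rewrite !mxE.
Qed.

End Completion.

Section Final.
Variable R : realType.
Local Notation C := R[i].
Implicit Types (D : 'M[C]_(2, 4)) (a z v : 'rV[C]_4) (u : 'rV[R]_4).
Local Notation real8 := (@real8_of_complex R).

Definition normsq (w : C) : R := Re w ^+ 2 + Im w ^+ 2.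

Lemma normsq_eq0 w : (normsq w == 0) = (w == 0).
Proof. by rewrite /normsq paddr_eq0 ?sqr_ge0 // !sqrf_eq0 eq_complex. Qed.

Lemma normsqM w w' : normsq (w * w') = normsq w * normsq w'.
Proof. by rewrite /normsq; case: w w' => x y [x' y'] /=; ring. Qed.

(** One polynomial whose nonvanishing gathers all the conditions on the plane used above. *)
Definition genericity a D : R :=
  im_cross_base a D * im_cross_directions D *
  (normsq (minor3 a D o0 o1 o2) * normsq (minor3 a D o1 o2 o3)).

Lemma complex_of_real8K x : real8 (complex_of_real8 x) = x :> 'rV[R]_(4 + 4).
Proof. by apply: rV_split_eq => j; rewrite ?real8_l ?real8_r !mxE. Qed.

(** Near a critical point z, the critical set is given by linear equations, which say
    that x - z is in the direction of the plane, and by det (arg_mx D x) = 0.  By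
    arg_det_regular some vector of a basis adapted to the plane has a nonzero derivative;
    exchanging it with the one of index 3 puts the determinant in the right coordinate. *)
Lemma critical_submanifold a D : row_free D -> genericity a D != 0 ->
  smooth_submanifold 3 (real8 @` rolled_coamoeba_critical (affine_plane_of a D)).
Proof.
move=> Df; rewrite /genericity !mulf_eq0 !negb_or !normsq_eq0 => /andP[/andP[g1 g2] /andP[q3 q0]].
move=> p [z /criticalP -/(_ Df)[Vz z0 dM] <-{p}].
have [k dk] := arg_det_regular Df z0 Vz g1 g2 q3 q0 dM.
set T := real_frame D in dk.
have Tf : row_free T by exact: real_frame_free.
pose E := row_ebase T; have Eu : E \in unitmx by exact: row_ebase_unit.
pose g l := arg_det_grad D l (real8 z).
have [i0 i04 di0] : exists2 i0 : 'I_(4 + 4), (i0 < 4)%N & \sum_l E i0 l * g l != 0.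
  apply: contrapT => nE; case/negP: dk; apply/eqP.
  have dE (i : 'I_(4 + 4)) : (i < 4)%N -> \sum_l E i l * g l = 0.
    by move=> i4; apply: contrapT => /eqP di; apply: nE; exists i.
  have /sub_row_ebaseP -/(_ Tf) kT : (row k T <= T)%MS by exact: row_sub.
  transitivity (\sum_i (row k T *m invmx E) 0 i * \sum_l E i l * g l).
    under [RHS]eq_bigr do rewrite mulr_sumr.
    rewrite exchange_big /=; apply: eq_bigr => l _.
    under [RHS]eq_bigr do rewrite mulrA.
    rewrite -mulr_suml; congr (_ * _).
    have := mulmxKV Eu (row k T) => /rowP/(_ l); rewrite mxE => ->.
    by rewrite [RHS]mxE.
  apply: big1 => i _; have [i4|i4] := ltnP i 4; first by rewrite dE ?mulr0.
  by rewrite kT ?mul0r.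
pose k3 : 'I_(4 + 4) := @Ordinal (4 + 4) 3 isT.
pose s := tperm i0 k3.
pose B := row_perm s E.
have Bu : B \in unitmx by rewrite /B row_permE unitmx_mul unitmx_perm.
have BE (v : 'rV[R]_(4 + 4)) : v *m invmx B = col_perm s (v *m invmx E).
  by rewrite -{1}(mulmxKV Eu v) -(mul_row_perm s (v *m invmx E) E) mulmxK.
have colE (y : 'rV[R]_(4 + 4)) j : col_perm s y 0 j = y 0 (s j) by rewrite mxE.
have Bk3 : \sum_l B k3 l * g l != 0.
  by under eq_bigr do rewrite mxE /s tpermR.
pose O := [set x : 'rV[R]_(4 + 4) |
  \prod_j (x 0 (lshift 4 j) * x 0 (lshift 4 j) + x 0 (rshift 4 j) * x 0 (rshift 4 j)) != 0].
have OP z' : O (real8 z') <-> forall j, z' 0 j != 0.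
  have nE j : (real8 z' 0 (lshift 4 j) * real8 z' 0 (lshift 4 j) +
      real8 z' 0 (rshift 4 j) * real8 z' 0 (rshift 4 j) != 0) = (z' 0 j != 0).
    by rewrite real8_l real8_r -!expr2 -/(normsq _) normsq_eq0.
  split=> [/prodf_neq0 Oz j|Oz]; first by rewrite -nE Oz.
  by apply/prodf_neq0 => j _; rewrite nE.
have oO : open O.
  apply: open_neq0; apply: Ck_prod; first exact: openT.
  move=> j; have lC := Ck_coord 1 setT (lshift 4 j : 'I_(4 + 4)).
  have rC := Ck_coord 1 setT (rshift 4 j : 'I_(4 + 4)).
  by apply: CkD; apply: CkM => //; exact: openT.
have [h Sh hE] := arg_det_gradP D (@openT 'rV[R]_(4 + 4)).
have hk3 : \sum_j B k3 j * h j (real8 z, real8 z) != 0 by under eq_bigr do rewrite hE.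
have [U [W [phi [psi [dphi Up UO phiE]]]]] := straighten_affine Bu oO ((OP z).2 z0)
  (fun l => arg_det_smooth D l openT) Sh dM hk3.
exists U, W, phi, psi; split=> // x Ux.
have [fE cE] := phiE x.
pose z' := complex_of_real8 x; have xE : real8 z' = x by exact: complex_of_real8K.
have zV : (z' - a <= D)%MS <-> forall j : 'I_(4 + 4), (4 <= j)%N -> phi x 0 j = 0.
  have -> : (z' - a <= D)%MS <-> (x - real8 z <= T)%MS.
    rewrite -xE -real8B -sub_real_frame; split=> h1.
      have -> : z' - z = (z' - a) - (z - a) by rewrite opprB addrA subrK.
      by apply: addmx_sub => //; rewrite eqmx_opp.
    have -> : z' - a = (z' - z) + (z - a) by rewrite addrA subrK.
    exact: addmx_sub.
  have jne (j : 'I_(4 + 4)) : (4 <= j)%N -> s j = j /\ j != k3.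
    move=> j4; have jk3 : j != k3 by rewrite -val_eqE /= neq_ltn orbC j4.
    by split=> //; rewrite /s tpermD // eq_sym // -val_eqE neq_ltn orbC (leq_trans i04).
  rewrite (sub_row_ebaseP Tf); split=> h1 j j4.
    by have [sj jk3] := jne j j4; rewrite cE // BE colE sj h1.
  by have [sj jk3] := jne j j4; rewrite -(h1 j j4) cE // BE colE sj.
split=> [[z1 /criticalP -/(_ Df)[V1 z10 d1] z1x] j j3|phi0].
  have z1E : z1 = z' by apply: real8_inj; rewrite xE.
  have [->|jk3] := eqVneq j k3; first by apply/fE; rewrite -z1x.
  apply: zV.1; first by rewrite -z1E.
  by rewrite ltn_neqAle j3 eq_sym andbT; move: jk3; rewrite -val_eqE.
exists z' => //; apply/criticalP => //; split.
- by apply/zV => j j4; apply: phi0; exact: ltnW.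
- by apply/OP; rewrite xE; exact: UO.
- by rewrite xE; apply/fE; apply: phi0.
Qed.

End Final.

(** * Genericity is algebraic and does not depend on the frame *)

Section Invariance.
Variable R : realType.
Local Notation C := R[i].
Implicit Types (D : 'M[C]_(2, 4)) (a z v : 'rV[C]_4).

Lemma plane_frame_change a D a' D' : affine_plane_of a D = affine_plane_of a' D' ->
  (a' - a <= D)%MS /\ exists g : 'M[C]_2, D' = g *m D.
Proof.
move=> VE.
have aV : (a' - a <= D)%MS.
  have : affine_plane_of a' D' a' by rewrite /affine_plane_of /= subrr sub0mx.
  by rewrite -VE.
split=> //; apply/submxP; apply/row_subP => e.
have : affine_plane_of a' D' (a' + row e D').
  by rewrite /affine_plane_of /= addrAC subrr add0r row_sub.
rewrite -VE /affine_plane_of /= => h.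
have -> : row e D' = (a' + row e D' - a) - (a' - a) by rewrite opprB addrA subrK addrAC subrr add0r.
by apply: addmx_sub => //; rewrite eqmx_opp.
Qed.

(** All minors are multiplied by the determinant d of g, so genericity is multiplied by
    a power of |d|. *)
Lemma genericity_frame_change a D a' g : (a' - a <= D)%MS ->
  exists c, genericity a' (g *m D) = c * genericity a D.
Proof.
move=> aa.
pose d := g 0 0 * g 1 1 - g 0 1 * g 1 0.
have gE e j : (g *m D) e j = g e 0 * D 0 j + g e 1 * D 1 j.
  by rewrite mxE !big_ord_recl big_ord0 addr0; congr (_ + g _ _ * D _ j); exact: val_inj.
have m2 i j : minor2 (g *m D) i j = d * minor2 D i j by rewrite /minor2 !gE /d; ring.
have m3 i j k : minor3 a' (g *m D) i j k = d * minor3 a D i j k.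
  by rewrite -(minor3_translate i j k aa) /minor3 !m2; ring.
have ImD (x x' y y' : C) : Im (d * x * (d * x') * conjc (d * y * (d * y'))) =
    normsq (d * d) * Im (x * x' * conjc (y * y')).
  rewrite !(mulrACA d _ d); move: (d * d) (x * x') (y * y') => w x0 y0.
  by rewrite /normsq; case: w x0 y0 => ? ? [? ?] [? ?] /=; ring.
exists (normsq (d * d) * normsq (d * d) * (normsq d * normsq d)).
by rewrite /genericity /im_cross_base /im_cross_directions !m2 !m3 !ImD !normsqM; ring.
Qed.

End Invariance.

Section Polynomial.
Variables (R : realType) (n : nat).
Local Notation C := R[i].

Definition polyfun (f : 'rV[R]_n -> R) : Prop :=
  exists p : mpoly.mpoly n R, forall v : 'rV[R]_n, mpoly.meval (v 0) p = f v.

Lemma polyfun_coord i : polyfun (fun v : 'rV[R]_n => v 0 i).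
Proof. by eexists => v; exact: mpoly.mevalXU. Qed.

Lemma polyfunD f g : polyfun f -> polyfun g -> polyfun (fun v => f v + g v).
Proof. by move=> [p pE] [q qE]; eexists => v; rewrite -pE -qE; exact: mpoly.mevalD. Qed.

Lemma polyfunN f : polyfun f -> polyfun (fun v => - f v).
Proof. by move=> [p pE]; eexists => v; rewrite -pE; exact: mpoly.mevalN. Qed.

Lemma polyfunM f g : polyfun f -> polyfun g -> polyfun (fun v => f v * g v).
Proof. by move=> [p pE] [q qE]; eexists => v; rewrite -pE -qE; exact: mpoly.mevalM. Qed.

Lemma polyfun_eq f g : f =1 g -> polyfun f -> polyfun g.
Proof. by move=> fg [p pE]; exists p => v; rewrite pE. Qed.

Definition cpolyfun (f : 'rV[R]_n -> C) : Prop :=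
  polyfun (fun v => Re (f v)) /\ polyfun (fun v => Im (f v)).

Lemma cpolyfunD f g : cpolyfun f -> cpolyfun g -> cpolyfun (fun v => f v + g v).
Proof.
move=> [f1 f2] [g1 g2]; split.
  by apply: polyfun_eq (polyfunD f1 g1) => v; case: (f v) (g v) => ? ? [].
by apply: polyfun_eq (polyfunD f2 g2) => v; case: (f v) (g v) => ? ? [].
Qed.

Lemma cpolyfunN f : cpolyfun f -> cpolyfun (fun v => - f v).
Proof.
move=> [f1 f2]; split.
  by apply: polyfun_eq (polyfunN f1) => v; case: (f v).
by apply: polyfun_eq (polyfunN f2) => v; case: (f v).
Qed.

Lemma cpolyfunM f g : cpolyfun f -> cpolyfun g -> cpolyfun (fun v => f v * g v).
Proof.
move=> [f1 f2] [g1 g2]; split.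
  apply: polyfun_eq (polyfunD (polyfunM f1 g1) (polyfunN (polyfunM f2 g2))) => v.
  by case: (f v) (g v) => ? ? [].
apply: polyfun_eq (polyfunD (polyfunM f1 g2) (polyfunM f2 g1)) => v.
by case: (f v) (g v) => ? ? [].
Qed.

Lemma cpolyfun_conj f : cpolyfun f -> cpolyfun (fun v => conjc (f v)).
Proof.
move=> [f1 f2]; split.
  by apply: polyfun_eq f1 => v; case: (f v).
by apply: polyfun_eq (polyfunN f2) => v; case: (f v).
Qed.

End Polynomial.

Section Genericity.
Variable R : realType.
Local Notation C := R[i].
Local Notation N := (3 * 4 + 3 * 4)%N.
Implicit Types (D : 'M[C]_(2, 4)) (a z v : 'rV[C]_4).

Definition coords_entry (w : 'rV[R]_N) (i : 'I_3) (j : 'I_4) : C :=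
  w 0 (lshift (3 * 4) (mxvec_index i j)) +i* w 0 (rshift (3 * 4) (mxvec_index i j)).
Definition coords_base (w : 'rV[R]_N) : 'rV[C]_4 :=
  \row_j coords_entry w (lshift 2 (0 : 'I_1)) j.
Definition coords_span (w : 'rV[R]_N) : 'M[C]_(2, 4) :=
  \matrix_(e, j) coords_entry w (rshift 1 e) j.

Lemma coords_entry_frame a D i j :
  coords_entry (frame_coords a D) i j = (col_mx a D : 'M[C]_(3, 4)) i j.
Proof.
rewrite /coords_entry /frame_coords row_mxEl row_mxEr !mxvecE ![map_mx _ _ _ _]mxE.
by case: (col_mx a D i j).
Qed.

Lemma coords_base_frame a D : coords_base (frame_coords a D) = a.
Proof. by apply/rowP => j; rewrite mxE coords_entry_frame; exact: col_mxEu. Qed.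

Lemma coords_span_frame a D : coords_span (frame_coords a D) = D.
Proof. by apply/matrixP => e j; rewrite mxE coords_entry_frame; exact: col_mxEd. Qed.

Lemma genericity_polyfun : polyfun (fun w => genericity (coords_base w) (coords_span w)).
Proof.
have entry i j : cpolyfun (fun w => coords_entry w i j) by split; exact: polyfun_coord.
have base j : cpolyfun (fun w => coords_base w 0 j).
  have [e1 e2] := entry (lshift 2 (0 : 'I_1)) j.
  by split; [apply: polyfun_eq e1|apply: polyfun_eq e2] => w; rewrite mxE.
have span e j : cpolyfun (fun w => coords_span w e j).
  have [e1 e2] := entry (rshift 1 e) j.
  by split; [apply: polyfun_eq e1|apply: polyfun_eq e2] => w; rewrite mxE.
have m2 i j : cpolyfun (fun w => minor2 (coords_span w) i j).
  by apply: cpolyfunD; [|apply: cpolyfunN]; apply: cpolyfunM.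
have m3 i j k : cpolyfun (fun w => minor3 (coords_base w) (coords_span w) i j k).
  by apply: cpolyfunD; [apply: cpolyfunD; [|apply: cpolyfunN]|]; apply: cpolyfunM.
have nsq f : cpolyfun f -> polyfun (fun w : 'rV[R]_N => normsq (f w)).
  by move=> [f1 f2]; apply: polyfunD; apply: polyfunM.
have im f g : cpolyfun f -> cpolyfun g -> polyfun (fun w : 'rV[R]_N => Im (f w * conjc (g w))).
  by move=> fC gC; case: (cpolyfunM fC (cpolyfun_conj gC)).
apply: polyfunM; last by apply: polyfunM; apply: nsq.
by apply: polyfunM; apply: im; apply: cpolyfunM.
Qed.

Definition nongeneric : set (set 'rV[C]_4) :=
  [set V | exists a D, [/\ row_free D, V = affine_plane_of a D & genericity a D = 0]].

(** Membership may be tested on any frame of the plane, by invariance. *)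
Lemma nongenericP a D : row_free D -> nongeneric (affine_plane_of a D) <-> genericity a D = 0.
Proof.
move=> Df; split=> [[a' [D' [_ VE g0]]]|g0]; last by exists a, D.
have [aa [g DE]] := plane_frame_change (esym VE).
by have [c] := genericity_frame_change g aa; rewrite -DE g0 mulr0.
Qed.

Lemma nongeneric_algebraic : real_algebraic nongeneric.
Proof.
have [p pE] := genericity_polyfun.
exists [:: p] => a D Df; rewrite nongenericP //= andbT pE coords_base_frame coords_span_frame.
by split=> /eqP.
Qed.

(** Its minors are small Gaussian integers, so that genericity can be computed by hand. *)
Definition sample_base : 'rV[C]_4 := \row_j nth 0 [:: 0; 0; 2; 1] j.
Definition sample_span : 'M[C]_(2, 4) :=
  \matrix_(e, j) nth 0 (nth [::] [:: [:: 1; 0; 'i%C; 1]; [:: 0; 1; 1; 1]] e) j.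

Lemma sample_generic : row_free sample_span /\ genericity sample_base sample_span != 0.
Proof.
split.
  apply: inj_row_free => v vD.
  have := congr1 (fun u : 'rV_4 => u 0 o0) vD; have := congr1 (fun u : 'rV_4 => u 0 o1) vD.
  rewrite /= !mxE !big_ord_recl !big_ord0 !mxE /= !mulr0 !mulr1 !addr0 !add0r => v1 v0.
  apply/rowP => e; rewrite mxE.
  by case: e => -[|[|//]] lt; [rewrite -[RHS]v0|rewrite -[RHS]v1]; congr (v 0 _); exact: val_inj.
have p01 : minor2 sample_span o0 o1 = 1 by rewrite /minor2 !mxE /=; ring.
have p02 : minor2 sample_span o0 o2 = 1 by rewrite /minor2 !mxE /=; ring.
have p03 : minor2 sample_span o0 o3 = 1 by rewrite /minor2 !mxE /=; ring.
have p12 : minor2 sample_span o1 o2 = - 'i%C by rewrite /minor2 !mxE /=; ring.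
have p13 : minor2 sample_span o1 o3 = - 1 by rewrite /minor2 !mxE /=; ring.
have p23 : minor2 sample_span o2 o3 = 'i%C - 1 by rewrite /minor2 !mxE /=; ring.
have q013 : minor3 sample_base sample_span o0 o1 o3 = 1.
  by rewrite /minor3 p01 p03 p13 !mxE /=; ring.
have q023 : minor3 sample_base sample_span o0 o2 o3 = - 1.
  by rewrite /minor3 p02 p03 p23 !mxE /=; ring.
have q012 : minor3 sample_base sample_span o0 o1 o2 = 2.
  by rewrite /minor3 p01 p02 p12 !mxE /=; ring.
have q123 : minor3 sample_base sample_span o1 o2 o3 = 2 - 'i%C.
  by rewrite /minor3 p12 p13 p23 !mxE /=; ring.
have two0 : 2 - 'i%C != 0 :> C.
  by apply/eqP => /(congr1 Im) /= /eqP; rewrite !add0r oppr_eq0 oner_eq0.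
rewrite /genericity !mulf_neq0 ?normsq_eq0 ?q012 ?q123 ?pnatr_eq0 //.
  rewrite /im_cross_base p13 p23 q013 q023 /= [X in X != 0](_ : _ = 1) ?oner_eq0 //; ring.
rewrite /im_cross_directions p01 p02 p13 p23 /=.
by rewrite [X in X != 0](_ : _ = -1) ?oppr_eq0 ?oner_eq0 //; ring.
Qed.

End Genericity.

Theorem corollary1 (R : realType) :
  @for_generic_plane R (fun V =>
    smooth_submanifold 3
      (@real8_of_complex R @` @rolled_coamoeba_critical R V)%classic).
Proof.
exists (@nongeneric R); split; first exact: nongeneric_algebraic.
  have [Df g0] := sample_generic R.
  exists (affine_plane_of (sample_base R) (sample_span R)).
    by exists (sample_base R), (sample_span R).
  by move/(nongenericP _ Df)/eqP; rewrite (negPf g0).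
move=> V [a [D [Df ->]]] nV; apply: critical_submanifold => //.
by apply/eqP => g0; apply: nV; apply/nongenericP.
Qed.
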